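(* Let $(X_1,d_1,\mu_1)$ and $(X_2,d_2,\mu_2)$ be two metric measure spaces and let $\mathsf{D}_{\mathrm{ET}}$ be a regular Entropy-Transport distance induced by $(a,F,\ell)$, with induced Sturm-Entropy-Transport distance $\mathbf{D}_{\mathrm{ET}}$. (i) In the definition of $\mathbf{D}_{\mathrm{ET}}$ one can suppose without loss of generality that $\hat X=X_1\sqcup X_2$, that $\psi^1=\iota_1$, $\psi^2=\iota_2$ are the inclusions of $X_1$ and $X_2$ in $X_1\sqcup X_2$, and that the infimum is taken over all finite valued pseudo-metric couplings $\hat d$ between $d_1$ and $d_2$; that is, $$\mathbf{D}_{\mathrm{ET}}\big((X_1,d_1,\mu_1),(X_2,d_2,\mu_2)\big)=\inf_{\hat d}\,(\mathsf{D}_{\mathrm{ET}})_{\hat d}\big((\iota_1)_\sharp\mu_1,(\iota_2)_\sharp\mu_2\big).$$ (ii) It holds $$\mathbf{D}_{\mathrm{ET}}^{1/a}\big((X_1,d_1,\mu_1),(X_2,d_2,\mu_2)\big)=\inf_{(\gamma,\hat d)\in C}\Big\{\sum_{i=1}^2D_F(\gamma_i\|\mu_i)+\int_{X_1\times X_2}\ell\big(\hat d(x,y)\big)\,d\gamma(x,y)\Big\},$$ where $C:=\{(\gamma,\hat d):\ \gamma\in\mathscr{M}(X_1\times X_2),\ \hat d \text{ finite valued pseudo-metric coupling for } d_1,d_2\}$ and $\gamma_1,\gamma_2$ are the marginals of $\gamma$.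
   Context: A pseudo-metric is a symmetric function vanishing on the diagonal and satisfying the triangle inequality. For a metric or pseudo-metric space $X$ (topology generated by open balls), $\mathscr{M}(X)$ denotes the set of finite nonnegative Borel measures on $X$, endowed with the weak topology. $\Gamma_0(\mathbb{R}_+)$ is the set of convex, lower semicontinuous $F:[0,\infty)\to[0,\infty]$ with $F(1)=0$; $F'_\infty:=\lim_{s\to\infty}F(s)/s$, and $F$ is superlinear if $F'_\infty=+\infty$. The $F$-divergence is $D_F(\gamma\|\mu):=\int_X F(\sigma)\,d\mu+F'_\infty\,\gamma^\perp(X)$, where $\gamma=\sigma\mu+\gamma^\perp$ is the Lebesgue decomposition of $\gamma$ with respect to $\mu$ (with $\infty\cdot 0=0$). The Entropy-Transport cost induced by $F$ and a lower semicontinuous cost $c:X\times X\to[0,\infty]$ is $$\mathrm{ET}(\mu_1,\mu_2):=\inf_{\gamma\in\mathscr{M}(X\times X)}\Big\{D_F(\gamma_1\|\mu_1)+D_F(\gamma_2\|\mu_2)+\int_{X\times X} c\,d\gamma\Big\},$$ where $\gamma_i=(\pi^i)_\sharp\gamma$ are the marginals of $\gamma$. Regular Entropy-Transport distance induced by $(a,F,\ell)$: here $a\in(0,1]$, $F\in\Gamma_0(\mathbb{R}_+)$ is superlinear and finite valued, $\ell:[0,\infty)\to[0,\infty]$ is continuous, convex, with $\ell(s)=0$ iff $s=0$; for every complete separable metric space $(X,d)$ one sets $\mathsf{D}_{\mathrm{ET}}:=\mathrm{ET}^a$ on $\mathscr{M}(X)$, with $\mathrm{ET}$ induced by $F$ and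 $c(x_1,x_2)=\ell(d(x_1,x_2))$, and it is required that, for every complete separable metric space $(X,d)$, $\mathsf{D}_{\mathrm{ET}}$ is a complete and separable metric on $\mathscr{M}(X)$ inducing the weak topology. For a pseudo-metric space with finite valued pseudo-metric $\hat d$, $(\mathsf{D}_{\mathrm{ET}})_{\hat d}$ denotes the quantity $\mathrm{ET}^a$ defined by the same formula with cost $\ell\circ\hat d$. A metric measure space is a triple $(X,d,\mu)$ with $(X,d)$ a complete separable metric space and $\mu\in\mathscr{M}(X)$; $\mathsf{supp}(\mu)$ is the support of $\mu$. The Sturm-Entropy-Transport distance is $$\mathbf{D}_{\mathrm{ET}}\big((X_1,d_1,\mu_1),(X_2,d_2,\mu_2)\big):=\inf\ \mathsf{D}_{\mathrm{ET}}(\psi^1_\sharp\mu_1,\psi^2_\sharp\mu_2),$$ the infimum over all complete separable metric spaces $(\hat X,\hat d)$ and isometric embeddings $\psi^i:\mathsf{supp}(\mu_i)\to\hat X$, $i=1,2$ (with $\mathsf{D}_{\mathrm{ET}}$ computed in $(\hat X,\hat d)$). A pseudo-metric coupling between $d_1$ and $d_2$ is a pseudo-metric $\hat d$ on the disjoint union $X_1\sqcup X_2$ whose restriction to $X_i\times X_i$ is $d_i$, $i=1,2$. *)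

(* Defs.v *)
From HB Require Import structures.
From mathcomp Require Import all_boot all_order all_algebra.
From mathcomp Require Import all_classical all_reals all_analysis.
Set Implicit Arguments.
Unset Strict Implicit.
Unset Printing Implicit Defensive.
Import Order.TTheory GRing.Theory Num.Theory.
Import numFieldNormedType.Exports.
Local Open Scope classical_set_scope.
Local Open Scope ring_scope.

(* Spaces are nonempty, because measurableType inherits from pointedType; the
   base point is never used. *)
#[short(type="completeMetricType")]
HB.structure Definition CompleteMetric (R : realType) :=
  {T of CompletePseudoMetric R T & Metric R T}.

Definition separable (T : topologicalType) :=
  exists2 S : set T, countable S & dense S.

Record pseudo_dist (R : realType) (T : Type) := PseudoDist {
  pdist :> T -> T -> R ;
  pdistxx : forall x, pdist x x = 0 ;
  pdist_sym : forall x y, pdist x y = pdist y x ;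
  pdist_triangle : forall y x z, pdist x z <= pdist x y + pdist y z }.

(* T with the topology generated by the open balls of d *)
Definition pspace (R : realType) (T : pointedType) (d : pseudo_dist R T) : Type :=
  T.

Section pspace_topology.
Context (R : realType) (T : pointedType) (d : pseudo_dist R T).
Local Notation M := (pspace d).

Let ball (x : M) (e : R) : set M := [set y | d x y < e].
Let ent : set_system (M * M) := entourage_ ball.
Let nbhs (x : M) : set_system M := nbhs_ ent x.
Let nbhsE : nbhs = nbhs_ ent. Proof. by []. Qed.

HB.instance Definition _ := Pointed.on M.
HB.instance Definition _ := hasNbhs.Build M nbhs.

Let ball_center x (e : R) : 0 < e -> ball x e x.
Proof. by move=> e0; rewrite /ball/= pdistxx. Qed.

Let ball_sym x y (e : R) : ball x e y -> ball y e x.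
Proof. by rewrite /ball/= pdist_sym. Qed.

Let ball_triangle x y z e1 e2 : ball x e1 y -> ball y e2 z ->
  ball x (e1 + e2) z.
Proof.
by rewrite /ball/= => ? ?; rewrite (le_lt_trans (pdist_triangle d y _ _))// ltrD.
Qed.

Let entourageE : ent = entourage_ ball. Proof. by []. Qed.

HB.instance Definition _ := @Nbhs_isPseudoMetric.Build R M
  ent nbhsE ball ball_center ball_sym ball_triangle entourageE.
End pspace_topology.

HB.instance Definition _ (T1 : pointedType) (T2 : choiceType) :=
  isPointed.Build (T1 + T2)%type (inl point).

(* product topology, pointed; borel (T * S) is its Borel sigma-algebra *)
HB.instance Definition _ (T S : ptopologicalType) := Pointed.on (T * S)%type.

Definition borel (T : ptopologicalType) : Type := g_sigma_algebraType (@open T).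
HB.instance Definition _ (T : ptopologicalType) := Measurable.on (borel T).

Definition fmeas (R : realType) (T : ptopologicalType) : Type :=
  {finite_measure set (borel T) -> \bar R}.
HB.instance Definition _ (R : realType) (T : ptopologicalType) :=
  gen_eqMixin (fmeas R T).
HB.instance Definition _ (R : realType) (T : ptopologicalType) :=
  gen_choiceMixin (fmeas R T).

Section weak_topology.
Context (R : realType) (T : ptopologicalType).

Definition Cb : Type :=
  {f : T -> R | continuous f /\ [bounded f x | x in [set: T]]}.

Definition int_Cb (mu : fmeas R T) : {ptws Cb -> R} :=
  fun f => \int[mu]_x sval f x.

(* weak topology: the coarsest one making mu |-> \int f dmu continuous for
   every bounded continuous f *)
Definition weakly_open (U : set (fmeas R T)) : Prop :=
  @open (initial_topology int_Cb) U.
End weak_topology.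

Local Open Scope ereal_scope.

Section metrizes.
Context (R : realType) (T : ptopologicalType).
Variable D : fmeas R T -> fmeas R T -> \bar R.

(* Elements of fmeas R T are set functions on all subsets of T; two of them are
   the same Borel measure when they agree on Borel sets. *)
Definition is_metric_on_measures : Prop :=
  [/\ forall mu nu, 0 <= D mu nu < +oo,
      forall mu nu, D mu nu = 0 <-> (forall A, measurable A -> mu A = nu A),
      forall mu nu, D mu nu = D nu mu &
      forall nu mu rho, D mu rho <= D mu nu + D nu rho].

Definition is_complete_on_measures : Prop :=
  forall u : nat -> fmeas R T,
    (forall e : R, (0 < e)%R -> exists N : nat, forall m n : nat,
       (N <= m)%N -> (N <= n)%N -> D (u m) (u n) < e%:E) ->
    exists mu, forall e : R, (0 < e)%R -> exists N : nat, forall n : nat,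
      (N <= n)%N -> D (u n) mu < e%:E.

Definition is_separable_on_measures : Prop :=
  exists2 S : set (fmeas R T), countable S &
    forall mu (e : R), (0 < e)%R -> exists2 nu, S nu & D mu nu < e%:E.

Definition induces_weak_topology : Prop :=
  forall U : set (fmeas R T), weakly_open U <->
    forall mu, U mu -> exists2 e : R, (0 < e)%R &
      forall nu, D mu nu < e%:E -> U nu.
End metrizes.

Section divergence.
Context (R : realType).
Implicit Types F l : R -> \bar R.

(* Functions on [0, +oo[ are total functions on R of which only the values at
   nonnegative arguments are used. *)
Definition convex_nneg F : Prop :=
  forall x y t : R, (0 <= x)%R -> (0 <= y)%R -> (0 <= t <= 1)%R ->
    F (t * x + (1 - t) * y)%R <= t%:E * F x + (1 - t)%:E * F y.

Definition Gamma0 F : Prop :=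
  [/\ forall s : R, (0 <= s)%R -> 0 <= F s,
      convex_nneg F,
      lower_semicontinuous (F : subspace `[0%R, +oo[%classic -> \bar R) &
      F 1%R = 0].

Definition recession F : \bar R := lim (F s * (s^-1)%:E @[s --> +oo%R]).

Definition superlinear F : Prop := recession F = +oo.

Section Lebesgue_decomposition.
Context d (T : measurableType d).

Definition mutually_singular (nu mu : set T -> \bar R) : Prop :=
  exists N, [/\ measurable N, mu N = 0 & nu (~` N) = 0].

(* gamma = sigma mu + gammap *)
Definition is_Lebesgue_decomposition (gamma mu : set T -> \bar R)
    (sigma : T -> R) (gammap : {finite_measure set T -> \bar R}) : Prop :=
  [/\ measurable_fun setT sigma,
      forall x, (0 <= sigma x)%R,
      mutually_singular gammap mu &
      forall A, measurable A ->
        gamma A = \int[mu]_(x in A) (sigma x)%:E + gammap A].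

(* The decomposition exists and is unique up to mu-null modifications of sigma
   when gamma and mu are finite measures, so exactly one value v qualifies. *)
Definition F_divergence F (gamma mu : set T -> \bar R) : \bar R :=
  get [set v | exists sigma gammap,
    is_Lebesgue_decomposition gamma mu sigma gammap /\
    v = \int[mu]_x F (sigma x) + recession F * gammap setT].
End Lebesgue_decomposition.

Definition entropy_transport (T : ptopologicalType) F (c : T -> T -> \bar R)
    (mu1 mu2 : set (borel T) -> \bar R) : \bar R :=
  ereal_inf [set
    F_divergence F (pushforward gamma (fst : borel (T * T)%type -> borel T)) mu1
    + F_divergence F (pushforward gamma (snd : borel (T * T)%type -> borel T)) mu2
    + \int[gamma]_z c z.1 z.2 | gamma in [set: fmeas R (T * T)%type]].
End divergence.

Section Sturm.
Context (R : realType) (a : R) (F l : R -> \bar R).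

Definition ET_dist (X : completeMetricType R) (mu1 mu2 : set (borel X) -> \bar R)
    : \bar R :=
  entropy_transport F (fun x y => l (mdist x y)) mu1 mu2 `^ a.

Definition ET_pdist (X : pointedType) (d : pseudo_dist R X)
    (mu1 mu2 : set (borel (pspace d)) -> \bar R) : \bar R :=
  @entropy_transport R (pspace d) F (fun x y => l (d x y)) mu1 mu2 `^ a.

Record regular_ET : Prop := RegularET {
  regular_exponent : (0 < a <= 1)%R ;
  regular_entropy : Gamma0 F ;
  regular_superlinear : superlinear F ;
  regular_finite : forall s : R, (0 <= s)%R -> F s < +oo ;
  regular_cost_ge0 : forall s : R, (0 <= s)%R -> 0 <= l s ;
  regular_cost_continuous : {within `[0%R, +oo[%classic, continuous l} ;
  regular_cost_convex : convex_nneg l ;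
  regular_cost_eq0 : forall s : R, (0 <= s)%R -> (l s = 0 <-> s = 0%R) ;
  regular_metric : forall X : completeMetricType R, separable X ->
    let D := fun mu1 mu2 : fmeas R X => ET_dist mu1 mu2 in
    [/\ is_metric_on_measures D, is_complete_on_measures D,
        is_separable_on_measures D & induces_weak_topology D] }.

Definition support (X : ptopologicalType) (mu : set (borel X) -> \bar R) : set X :=
  [set x | forall U, open_nbhs x U -> 0 < mu U].

(* pushforward of mu (concentrated on its support) by a map that is only
   defined on the support *)
Definition push_support (X Y : ptopologicalType) (mu : set (borel X) -> \bar R)
    (psi : support mu -> Y) : set (borel Y) -> \bar R :=
  fun B => mu (set_val @` (psi @^-1` B)).

Definition isometric_on_support (X Y : completeMetricType R)
    (mu : set (borel X) -> \bar R) (psi : support mu -> Y) : Prop :=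
  forall x y, mdist (psi x) (psi y) = mdist (set_val x) (set_val y).

Section two_spaces.
Context (X1 X2 : completeMetricType R).

Definition Sturm_ET (mu1 : fmeas R X1) (mu2 : fmeas R X2) : \bar R :=
  ereal_inf [set v | exists Y : completeMetricType R,
    exists psi1 : support mu1 -> Y, exists psi2 : support mu2 -> Y,
    [/\ separable Y, isometric_on_support psi1, isometric_on_support psi2 &
        v = ET_dist (push_support psi1) (push_support psi2)]].

Definition pm_coupling (d : pseudo_dist R (X1 + X2)%type) : Prop :=
  (forall x y, d (inl x) (inl y) = mdist x y) /\
  (forall x y, d (inr x) (inr y) = mdist x y).
End two_spaces.
End Sturm.

(* Main.v *)
Require Import Defs.
From HB Require Import structures.
From mathcomp Require Import all_boot all_order all_algebra.
From mathcomp Require Import all_classical all_reals all_analysis.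
From mathcomp Require Import measurable_realfun generic_quotient lra.
Set Implicit Arguments.
Unset Strict Implicit.
Unset Printing Implicit Defensive.
Import Order.TTheory GRing.Theory Num.Theory.
Import numFieldNormedType.Exports.
Local Open Scope classical_set_scope.
Local Open Scope ring_scope.
Local Open Scope ereal_scope.

(* All three infima are compared with plans on X1 x X2. Since F is superlinear,
   a plan of finite cost on a space Y containing X1 and X2 isometrically has
   marginals that are absolutely continuous with respect to the images of mu1
   and mu2, hence concentrated on the (closed) images of their supports. By
   completeness these images have Borel retractions onto X1 and X2, so that the
   plan is carried over to X1 x X2 and back without changing its cost. For the
   Sturm distance, isometries psi_i into Y are turned into a coupling by gluing,
   d(x, y) = inf_{s, t} d1(x, s) + dY(psi1 s, psi2 t) + d2(t, y); conversely the
   metric quotient of X1 + X2 under a coupling is already complete, because a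
   Cauchy filter accumulates on X1 or on X2. *)

(** Costs on different product spaces are compared by inequalities only. An infinite right-hand side
    is trivial, so a density is at hand whenever a divergence has to be computed. Each map along
    which entropies are moved has a Borel inverse on one side; the density is composed with that
    inverse, and no Jensen inequality enters. The obstacle is measurability into products: plans
    live on the Borel sigma-algebra of the product topology, and the comparison does not assume Y
    separable. Maps into [Y * Y] are therefore obtained by continuity, available for isometries
    defined on the whole of X1 and X2, whereas the retractions into [X1 * X2] are only Borel in each
    coordinate and rely on separability of X1 and X2. The exponent a enters only at the end, through
    monotonicity of powers on [0, +oo]. *)

Section finite_measure_of.
Context d (T : measurableType d) (R : realType).
Variable mu : {measure set T -> \bar R}.

(** The proof of finiteness is an argument, so that the instance of finite measure declared below
    can recover it from the term. *)
Definition finite_measure_of of fin_num_fun mu : set T -> \bar R := mu.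

Variable fin_mu : fin_num_fun mu.
HB.instance Definition _ := Measure.copy (finite_measure_of fin_mu) mu.
HB.instance Definition _ :=
  Measure_isFinite.Build _ _ _ (finite_measure_of fin_mu) fin_mu.
End finite_measure_of.

Section image_measure.
Context d d' (T : measurableType d) (T' : measurableType d') (R : realType).
Variables (mu : {finite_measure set T -> \bar R}) (f : T -> T').
Hypothesis mf : measurable_fun setT f.

Let pf : {measure set T' -> \bar R} :=
  measure_function_pushforward__canonical__measure_function_Measure mu mf.

Let fin_pf : fin_num_fun pf.
Proof.
move=> A mA; apply: fin_num_measure.
by rewrite -[X in measurable X]setTI; exact: mf.
Qed.

Definition image_measure : {finite_measure set T' -> \bar R} :=
  finite_measure_of fin_pf.

Lemma ge0_integral_image_measure D (h : T' -> \bar R) :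
  measurable D -> measurable_fun D h -> {in D, forall y, 0 <= h y} ->
  \int[image_measure]_(y in D) h y = \int[mu]_(x in f @^-1` D) (h \o f) x.
Proof. exact: ge0_integral_pushforward. Qed.
End image_measure.

(** * Lebesgue decomposition, densities and the F-divergence *)

Section F_divergence.
Context d (T : measurableType d) (R : realType).
Implicit Types (F : R -> \bar R) (mu gamma : {finite_measure set T -> \bar R}).

Import HBNNSimple.

(** Needed because equality of measures is known on measurable sets only. The integral is built from
    suprema of simple integrals, which evaluate the set function only at level sets of simple
    functions, and these are measurable. *)
Lemma eq_integral_set_function (m m' : set T -> \bar R) D (f : T -> \bar R) :
  (forall A, measurable A -> m A = m' A) ->
  \int[m]_(x in D) f x = \int[m']_(x in D) f x.
Proof.
move=> mm'; have H g :
  [set sintegral m h | h in [set h : {nnsfun T >-> R} | forall x, (h x)%:E <= g x]] =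
  [set sintegral m' h | h in [set h : {nnsfun T >-> R} | forall x, (h x)%:E <= g x]].
  apply: eq_imagel => h _; apply: eq_fsbigr => r _; congr (_ * _).
  exact: mm'.
by rewrite /integral !H.
Qed.

Lemma eq_F_divergence F (g g' m m' : set T -> \bar R) :
  (forall A, measurable A -> g A = g' A) ->
  (forall A, measurable A -> m A = m' A) ->
  F_divergence F g m = F_divergence F g' m'.
Proof.
move=> gg' mm'; rewrite /F_divergence; congr get.
have H s p : is_Lebesgue_decomposition g m s p <-> is_Lebesgue_decomposition g' m' s p.
  split=> -[ms s0 [N [mN N0 pN]] E]; split => //.
  - by exists N; split; rewrite // -mm'.
  - by move=> A mA; rewrite -gg'// E// (eq_integral_set_function _ _ mm').
  - by exists N; split; rewrite // mm'.
  - by move=> A mA; rewrite gg'// E// (eq_integral_set_function _ _ mm').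
by apply/seteqP; split=> v [s [p [/H D ->]]]; exists s, p; split => //;
  rewrite (eq_integral_set_function _ _ mm').
Qed.

(** Radon-Nikodym is used twice: for [mu] against [mu + gamma], to locate the singular part, and for
    the remainder of [gamma] against [mu], to obtain the density. *)
Lemma Lebesgue_decomposition mu gamma :
  exists sigma gammap, is_Lebesgue_decomposition gamma mu sigma gammap.
Proof.
pose lam0 : {measure set T -> \bar R} := measure_add mu gamma.
have lam0E A : lam0 A = mu A + gamma A by exact: measure_addE.
have fin_lam0 : fin_num_fun lam0.
  by move=> A mA; rewrite lam0E fin_numD !fin_num_measure.
pose lam : {finite_measure set T -> \bar R} := finite_measure_of fin_lam0.
have lamE A : lam A = mu A + gamma A by exact: lam0E.
have mulam : mu `<< lam.
  apply/null_content_dominatesP => A mA lamA0.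
  have : mu A + gamma A == 0 by apply/eqP; rewrite -lamE.
  by rewrite padde_eq0// => /andP[/eqP].
have [g [g0 /integrableP[mg _] muE]] := radon_nikodym_finite mulam.
(* mu has density g with respect to mu + gamma; the singular part of gamma
   lives on the mu-null set where g vanishes. *)
pose N := g @^-1` [set 0].
have mN : measurable N by rewrite -[X in measurable X]setTI; exact: mg.
have mNC : measurable (~` N) by exact: measurableC.
have gNoo : gamma N < +oo by rewrite ltey_eq fin_num_measure.
have gNCoo : gamma (~` N) < +oo by rewrite ltey_eq fin_num_measure.
pose ga : {finite_measure set T -> \bar R} := mfrestr mNC gNCoo.
pose gs : {finite_measure set T -> \bar R} := mfrestr mN gNoo.
have muN : mu N = 0 by rewrite muE// integral0_eq.
(* If [mu A = 0], then [g] vanishes [lam]-almost everywhere on [A], so the part of [A] outside [N]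
   lies in a [lam]-null set, and [gamma <= lam]. *)
have gamu : ga `<< mu.
  apply/null_content_dominatesP => A mA muA0.
  have gA0 : \int[lam]_(x in A) g x = 0 by rewrite -muE.
  rewrite /ga /= /mfrestr /mrestr /=.
  have mgA : measurable_fun A g by exact: measurable_funTS.
  have : \int[lam]_(x in A) `|g x| = 0.
    by rewrite -gA0; apply: eq_integral => x _; rewrite gee0_abs.
  move=> /(ae_eq_integral_abs _ mA mgA) [B [mB B0 AB]].
  apply/eqP; rewrite -measure_le0 (le_trans _ (_ : lam B <= 0))//; last first.
    by rewrite B0.
  rewrite lamE (@le_trans _ _ (gamma B))// ?leeDr// le_measure ?inE//.
    exact: measurableI.
  by move=> x [Ax Nx]; apply: AB => /= /(_ Ax).
have [f [f0 ffin /integrableP[mf _] fE]] := radon_nikodym_sigma_finite gamu.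
exists (fine \o f), gs; split.
- exact: measurableT_comp.
- by move=> x; exact: fine_ge0.
- by exists N; split => //; rewrite /gs/= /mfrestr /mrestr setICl measure0.
- move=> A mA; rewrite (eq_integral f); last by move=> x _; rewrite fineK.
  rewrite -fE// /ga /gs/= /mfrestr /mrestr.
  rewrite -[in LHS](setIT A) -(setvU N) setIUr measureU//; last first.
  + by rewrite setIACA setICl setI0.
  + exact: measurableI.
  + exact: measurableI.
Qed.

Lemma ae_eq_of_integral_eq mu (f g : T -> R) :
  measurable_fun setT f -> measurable_fun setT g ->
  (forall x, 0 <= f x)%R -> (forall x, 0 <= g x)%R ->
  \int[mu]_x (f x)%:E < +oo ->
  (forall A, measurable A -> \int[mu]_(x in A) (f x)%:E = \int[mu]_(x in A) (g x)%:E) ->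
  ae_eq mu setT f g.
Proof.
move=> mf mg f0 g0 foo fg.
have : ae_eq mu setT (EFin \o f) (EFin \o g).
  apply: integral_ae_eq => //.
  - apply/integrableP; split; first exact/measurable_EFinP.
    by under eq_integral do rewrite /= ger0_norm//.
  - exact/measurable_EFinP.
  - by move=> E _ mE; exact: fg.
by apply: filterS => x /= H /H [].
Qed.

Section fixed_entropy.
Variable F : R -> \bar R.
Hypothesis F0 : forall s : R, (0 <= s)%R -> 0 <= F s.
Hypothesis mF : measurable_fun (`[0%R, +oo[%classic : set R) F.
Hypothesis Foo : superlinear F.

Lemma measurable_entropy (sigma : T -> R) :
  measurable_fun setT sigma -> (forall x, 0 <= sigma x)%R ->
  measurable_fun setT (F \o sigma).
Proof.
move=> ms s0; apply: (measurable_comp (F := (`[0%R, +oo[%classic : set R))) => //.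
by move=> _ [x _ <-] /=; rewrite in_itv/= s0.
Qed.

(** Existence of a decomposition already guarantees that [get] returns a value coming from some
    decomposition, though not from a prescribed one. *)
Lemma F_divergence_spec mu gamma : exists sigma gammap,
  is_Lebesgue_decomposition gamma mu sigma gammap /\
  F_divergence F gamma mu = \int[mu]_x F (sigma x) + recession F * gammap setT.
Proof.
have [s [p sp]] := Lebesgue_decomposition mu gamma.
rewrite /F_divergence; set A := (X in get X).
have : A (get A) by apply: (getPex (P := A)); eexists; exists s, p; split.
by [].
Qed.

Lemma F_divergence_ge0 mu gamma : 0 <= F_divergence F gamma mu.
Proof.
have [s [p [[ms s0 _ _] ->]]] := F_divergence_spec mu gamma.
rewrite Foo adde_ge0// ?mule_ge0 ?leey//.
by apply: integral_ge0 => x _; exact: F0.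
Qed.

(** Removes the choice hidden in [F_divergence]. The singular part [p] lives on a [mu]-null set [N],
    where [p N <= gamma N = 0], so it vanishes; the chosen density then agrees with [sigma] almost
    everywhere. *)
Lemma F_divergence_density mu gamma (sigma : T -> R) :
  measurable_fun setT sigma -> (forall x, 0 <= sigma x)%R ->
  (forall A, measurable A -> gamma A = \int[mu]_(x in A) (sigma x)%:E) ->
  F_divergence F gamma mu = \int[mu]_x F (sigma x).
Proof.
move=> ms s0 gs.
have [s' [p [[ms' s'0 [N [mN N0 pN0]] gs'] ->]]] := F_divergence_spec mu gamma.
have pT : p setT = 0.
  have -> : p setT = p N + p (~` N).
    by rewrite -measureU ?setUv ?setICr//; exact: measurableC.
  rewrite pN0 adde0; apply/eqP; rewrite -measure_le0.
  have <- : gamma N = 0.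
    rewrite gs//; apply: null_set_integral => //.
    by apply: measurable_funTS; exact/measurable_EFinP.
  by rewrite gs'// leeDr// integral_ge0// => x _; rewrite lee_fin.
have p0 A : measurable A -> p A = 0.
  move=> mA; apply/eqP; rewrite -measure_le0 -pT le_measure ?inE//.
rewrite pT mule0 adde0; apply: ge0_ae_eq_integral => //.
- exact: measurable_entropy.
- exact: measurable_entropy.
- by move=> x _; exact: F0.
- by move=> x _; exact: F0.
have : ae_eq mu setT s' sigma.
  apply: ae_eq_of_integral_eq => //.
  - have := gs' setT measurableT; rewrite pT adde0 => <-.
    by rewrite ltey_eq fin_num_measure.
  - by move=> A mA; rewrite -gs// gs'// p0// adde0.
by apply: filterS => x /= H /H ->.
Qed.

(** A singular part of positive mass would be multiplied by the recession constant [+oo]. *)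
Lemma F_divergence_finite_density mu gamma :
  F_divergence F gamma mu < +oo -> exists sigma : T -> R,
  [/\ measurable_fun setT sigma, forall x, (0 <= sigma x)%R &
    forall A, measurable A -> gamma A = \int[mu]_(x in A) (sigma x)%:E].
Proof.
have [s [p [[ms s0 _ gs] ->]]] := F_divergence_spec mu gamma.
have I0 : 0 <= \int[mu]_x F (s x) by apply: integral_ge0 => x _; exact: F0.
rewrite Foo => Hoo.
have pT : p setT = 0.
  apply/eqP; rewrite -measure_le0 leNgt; apply/negP => pT0.
  by move: Hoo; rewrite gt0_mulye// addey ?ltxx// gt_eqF// (lt_le_trans _ I0).
exists s; split => // A mA; rewrite gs//.
suff -> : p A = 0 by rewrite adde0.
by apply/eqP; rewrite -measure_le0 -pT le_measure ?inE//.
Qed.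

End fixed_entropy.
End F_divergence.

(** * The F-divergence under maps with a one-sided inverse *)

Section F_divergence_image.
Context d d' (T : measurableType d) (T' : measurableType d') (R : realType).
Variable F : R -> \bar R.
Hypothesis F0 : forall s : R, (0 <= s)%R -> 0 <= F s.
Hypothesis mF : measurable_fun (`[0%R, +oo[%classic : set R) F.
Hypothesis Foo : superlinear F.
Variables (mu : {finite_measure set T -> \bar R}) (f : T -> T') (g : T' -> T).
Hypotheses (mf : measurable_fun setT f) (mg : measurable_fun setT g).

(** A density [s] of [gamma] becomes the density [s \o g] of the image, and [g (f x) = x] gives back
    the same integral. *)
Lemma F_divergence_section (gamma : {finite_measure set T -> \bar R}) :
  cancel f g ->
  F_divergence F (image_measure gamma mf) (image_measure mu mf)
  <= F_divergence F gamma mu.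
Proof.
move=> fK; have [->|] := eqVneq (F_divergence F gamma mu) +oo;
  first exact: leey.
rewrite -ltey => /(F_divergence_finite_density F0 Foo)[s [ms s0 gs]].
have msg : measurable_fun setT (s \o g) by exact: measurableT_comp.
rewrite (F_divergence_density F0 mF ms s0 gs).
rewrite (@F_divergence_density _ _ _ _ F0 mF _ _ (s \o g)) //; first last.
- move=> A mA;
  rewrite ge0_integral_image_measure//; last 2 first.
    by apply: measurable_funTS; exact/measurable_EFinP.
    by move=> y _; rewrite lee_fin; exact: s0.
  transitivity (gamma (f @^-1` A)) => //.
  rewrite gs; last by rewrite -[X in measurable X]setTI; exact: mf.
  by apply: eq_integral => x _ /=; rewrite fK.
- by move=> y; exact: s0.
rewrite ge0_integral_image_measure//.
- rewrite preimage_setT (eq_integral (F \o s)) ?lexx//. move=> x _ /=.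
  by rewrite fK.
- by apply: (measurable_entropy mF msg) => y; exact: s0.
- by move=> y _; apply: F0; exact: s0.
Qed.

(** Here the density is composed with [f]. The identity [g (f x) = x] holds only on [S], which
    suffices because [mu] does not charge the complement. *)
Lemma F_divergence_retraction (gamma : {finite_measure set T' -> \bar R}) S :
  measurable S -> mu (~` S) = 0 -> (forall x, S x -> g (f x) = x) ->
  F_divergence F (image_measure gamma mg) mu
  <= F_divergence F gamma (image_measure mu mf).
Proof.
move=> mS S0 fK; set D := leRHS.
have [->|] := eqVneq D +oo; first exact: leey.
rewrite -ltey => /(F_divergence_finite_density F0 Foo)[s [ms s0 gs]].
have msf : measurable_fun setT (s \o f) by exact: measurableT_comp.
rewrite /D (F_divergence_density F0 mF ms s0 gs).
rewrite (@F_divergence_density _ _ _ _ F0 mF _ _ (s \o f)) //; first last.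
- move=> A mA;
  have mgA : measurable (g @^-1` A) by rewrite -[X in measurable X]setTI;
    exact: mg.
  transitivity (gamma (g @^-1` A)) => //; rewrite gs//.
  rewrite ge0_integral_image_measure//; last 2 first.
    by apply: measurable_funTS; exact/measurable_EFinP.
    by move=> y _; rewrite lee_fin; exact: s0.
  (* Both integrals are cut down to [S], where [A] and its preimage under [g \o f] coincide. *)
  rewrite (ge0_negligible_integral (measurableC mS))//; last 3 first.
    by rewrite -[X in measurable X]setTI; exact: mf.
    by apply: measurable_funTS; exact/measurable_EFinP.
    by move=> x _; rewrite lee_fin; exact: s0.
  rewrite [RHS](ge0_negligible_integral (measurableC mS))//; last 2 first.
    by apply: measurable_funTS; exact/measurable_EFinP.
    by move=> x _; rewrite lee_fin; exact: s0.
  congr integral; rewrite !setDE setCK; apply/seteqP; split=> x [] /= Ax Sx;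
    split => //.
    by rewrite -(fK _ Sx).
  by rewrite /preimage/= fK.
- by move=> y; exact: s0.
rewrite ge0_integral_image_measure//.
- exact: measurable_entropy.
- by move=> y _; apply: F0; exact: s0.
Qed.

End F_divergence_image.

(** * Borel sets and Borel maps in pseudo-metric spaces *)

Section metrized.
Context (R : realType).

(** Lets one set of lemmas serve both the metric spaces of the Sturm distance and the pseudo-metric
    spaces [pspace d]. *)
Definition metrized_by (T : ptopologicalType) (d : pseudo_dist R T) :=
  forall x (A : set T), nbhs x A <->
    exists2 e : R, (0 < e)%R & forall y, (d x y < e)%R -> A y.

Definition metric_dist (X : metricType R) : pseudo_dist R X :=
  PseudoDist (@mdistxx R X) (@metric_sym R X) (fun y x z => metric_triangle x y z).

Lemma metrized_by_mdist (X : completeMetricType R) :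
  metrized_by (metric_dist X).
Proof.
move=> x A; split=> [/nbhs_ballP[e /= e0 eA]|[e e0 eA]].
  by exists e => // y xy; apply: eA; rewrite ballEmdist.
by apply/nbhs_ballP; exists e => //= y; rewrite ballEmdist => /eA.
Qed.

Lemma metrized_by_pspace (T : pointedType) (d : pseudo_dist R T) :
  metrized_by (d : pseudo_dist R (pspace d)).
Proof.
move=> x A; split=> [/nbhs_ballP[e /= e0 eA]|[e e0 eA]].
  by exists e => // y xy; apply: eA.
by apply/nbhs_ballP; exists e => //= y /eA.
Qed.

Lemma pdist_ge0 (T : Type) (d : pseudo_dist R T) x y : (0 <= d x y)%R.
Proof.
have := pdist_triangle d y x x.
by rewrite pdistxx (pdist_sym d y x) -mulr2n pmulrn_lge0.
Qed.

Lemma pdist_eq0_eq (T : Type) (d : pseudo_dist R T) x y z :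
  d x y = 0%R -> d x z = d y z.
Proof.
move=> xy; apply/eqP; rewrite eq_le; apply/andP; split.
  by rewrite (le_trans (pdist_triangle d y _ _))// xy add0r.
by rewrite (le_trans (pdist_triangle d x _ _))// (pdist_sym d y) xy add0r.
Qed.

Section open_ball.
Context (T : ptopologicalType) (d : pseudo_dist R T).
Hypothesis dT : metrized_by d.

Lemma metrized_open_ball x (e : R) : open [set y | (d x y < e)%R].
Proof.
rewrite openE => y /= xy; apply/dT; exists (e - d x y)%R;
  first by rewrite subr_gt0.
by move=> z yz /=; rewrite (le_lt_trans (pdist_triangle d y _ _))// -ltrBrDl.
Qed.

Lemma metrized_open (A : set T) : open A <->
  forall x, A x -> exists2 e : R, (0 < e)%R & forall y, (d x y < e)%R -> A y.
Proof.
by rewrite openE; split=> [oA x /oA /dT//|H x /H]; rewrite /interior => /dT.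
Qed.

Lemma metrized_closed (A : set T) :
  (forall x, (forall e : R, (0 < e)%R -> exists2 y, A y & (d x y < e)%R) -> A x) ->
  closed A.
Proof.
move=> H x clx; apply: H => e e0.
have /clx [y [Ay xy]] : nbhs x [set y | (d x y < e)%R] by apply/dT; exists e.
by exists y.
Qed.
End open_ball.

Lemma borel_closed (T : ptopologicalType) (A : set (borel T)) :
  @closed T A -> measurable A.
Proof.
move=> cA; rewrite -(setCK A); apply: measurableC; apply: sub_gen_smallest.
exact: closed_openC.
Qed.

Lemma borel_open (T : ptopologicalType) (A : set (borel T)) :
  @open T A -> measurable A.
Proof. by move=> oA; exact: sub_gen_smallest. Qed.

Lemma borel_measurable_fun d (T : measurableType d) (T' : ptopologicalType)
  (f : T -> borel T') :
  (forall A, @open T' A -> measurable (f @^-1` A)) -> measurable_fun setT f.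
Proof.
move=> fA; apply: (@measurability _ _ T (borel T') setT f (@open T')) => // _ [A oA <-].
by rewrite setTI; exact: fA.
Qed.

Lemma borel_measurable_fun_closed d (T : measurableType d) (T' : ptopologicalType)
  (f : T -> borel T') :
  (forall A, @closed T' A -> measurable (f @^-1` A)) -> measurable_fun setT f.
Proof.
move=> fA; apply: borel_measurable_fun => A oA.
have /measurableC := fA (~` A) (open_closedC oA).
by rewrite -preimage_setC setCK.
Qed.

Lemma continuous_borel (T T' : ptopologicalType) (f : T -> T') :
  continuous f -> measurable_fun setT (f : borel T -> borel T').
Proof.
move=> /continuousP cf; apply: borel_measurable_fun => A oA.
by apply: borel_open; exact: cf.
Qed.

Lemma fst_borel (T T' : ptopologicalType) :
  measurable_fun setT (fst : borel (T * T')%type -> borel T).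
Proof. by apply: continuous_borel => -[x y]; exact: cvg_fst. Qed.

Lemma snd_borel (T T' : ptopologicalType) :
  measurable_fun setT (snd : borel (T * T')%type -> borel T').
Proof. by apply: continuous_borel => -[x y]; exact: cvg_snd. Qed.

Lemma metrized_continuous_dist (T : ptopologicalType) (d : pseudo_dist R T) :
  metrized_by d -> continuous (fun z : T * T => d z.1 z.2).
Proof.
move=> dT [x y]; apply/cvgrPdist_lt => e e0; near=> z => /=.
have zx : (d x z.1 < e / 2)%R.
  near: z; exists ([set u | (d x u < e / 2)%R], setT) => /=.
    by split; [apply/dT; exists (e / 2)%R => //; rewrite divr_gt0|exact: filterT].
  by move=> z [].
have zy : (d y z.2 < e / 2)%R.
  near: z; exists (setT, [set u | (d y u < e / 2)%R]) => /=.
    by split; [exact: filterT|apply/dT; exists (e / 2)%R => //; rewrite divr_gt0].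
  by move=> z [].
have h1 := pdist_triangle d z.1 x y; have h2 := pdist_triangle d z.2 z.1 y.
have h3 := pdist_triangle d x z.1 z.2; have h4 := pdist_triangle d y x z.2.
rewrite (pdist_sym d z.1 x) in h3; rewrite (pdist_sym d z.2 y) in h2.
by rewrite ltr_norml; apply/andP; split; lra.
Unshelve. all: by end_near. Qed.

Lemma measurable_dist (T : ptopologicalType) (d : pseudo_dist R T) :
  metrized_by d -> measurable_fun setT (fun z : borel (T * T)%type => d z.1 z.2).
Proof.
move=> dT; apply: (measurability _ (RGenOpens.measurableE R)).
move=> _ [_ [a [b ->] <-]]; rewrite setTI; apply: borel_open.
have /continuousP := metrized_continuous_dist dT; apply; exact: interval_open.
Qed.

End metrized.

(** * Isometric images of complete spaces and their Borel retractions *)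

Section isometry.
Context (R : realType) (X : completeMetricType R).

Definition isometric_on (Y : Type) (d : pseudo_dist R Y) (S : set X) (psi : X -> Y) :=
  forall x x', S x -> S x' -> d (psi x) (psi x') = mdist x x'.

(** The traces on [S] of the preimages of the sets of [G] form a Cauchy filter of X; its limit lies
    in the closed set [S] and is sent to a limit of [G]. This yields both the closedness of
    saturated images and the completeness of couplings. *)
Lemma isometric_cauchy_limit (Y : Type) (d : pseudo_dist R Y) (S : set X)
    (psi : X -> Y) (G : set_system Y) (GG : ProperFilter G) :
  closed S -> isometric_on d S psi ->
  (forall e : R, (0 < e)%R -> exists y, G [set z | (d y z < e)%R]) ->
  (forall A, G A -> exists2 x, S x & A (psi x)) ->
  exists2 x, S x & forall e : R, (0 < e)%R -> G [set z | (d (psi x) z < e)%R].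
Proof.
move=> cS iso cG GS; pose H := filter_from G (fun A => S `&` psi @^-1` A).
have FH : Filter H.
  apply: filter_from_filter; first by exists setT; exact: filterT.
  move=> A B GA GB; exists (A `&` B); first exact: filterI.
  by move=> x [Sx [Ax Bx]].
have PH : ProperFilter H.
  by apply: filter_from_proper => A /GS[x Sx Ax]; exists x.
have /cauchy_cvg cvgH : cauchy H.
  apply: cauchy_exP => e e0; have e20 : (0 < e / 2)%R by rewrite divr_gt0.
  have [y Gy] := cG _ e20; have [x Sx /= yx] := GS _ Gy.
  exists x, [set z | (d y z < e / 2)%R] => // x' [Sx' /= yx'].
  rewrite ballEmdist /= -iso// (le_lt_trans (pdist_triangle d y _ _))//.
  by rewrite (splitr e) ltrD// pdist_sym.
set x := lim H in cvgH; have Sx : S x.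
  apply: cS => B /cvgH[A GA AB]; have [x' Sx' Ax'] := GS _ GA.
  by exists x'; split => //; apply: AB.
(* Three errors add up: from [psi x] to [psi x'], from there to the centre [y] of a small set of
   [G], and from [y] to [z]. *)
exists x => // e e0; have e30 : (0 < e / 3)%R by rewrite divr_gt0.
have [y Gy] := cG _ e30.
have [A GA AB] := cvgH _ (nbhsx_ballx x _ e30).
have [x' Sx' [/= yx' Ax']] := GS _ (filterI Gy GA).
apply: filterS Gy => z /= yz.
have := AB _ (conj Sx' Ax'); rewrite ballEmdist/= -iso// => xx'.
have h1 := pdist_triangle d (psi x') (psi x) z.
have h2 := pdist_triangle d y (psi x') z; rewrite (pdist_sym d _ y) in h2.
by lra.
Qed.

Section retraction.
Context (Y : ptopologicalType) (d : pseudo_dist R Y) (S : set X) (psi : X -> Y).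
Hypothesis iso : isometric_on d S psi.

(* d need not separate points, so psi @` S itself need not be a Borel set. *)
Definition saturated_image : set Y :=
  [set y | exists2 x, S x & d (psi x) y = 0%R].

Definition isometry_retraction (y : Y) : X :=
  xget point [set x | S x /\ d (psi x) y = 0%R].

Lemma isometry_retractionP y : saturated_image y ->
  S (isometry_retraction y) /\ d (psi (isometry_retraction y)) y = 0%R.
Proof.
move=> [x Sx xy].
by apply: (xgetPex point (P := [set x | S x /\ d (psi x) y = 0%R])); exists x.
Qed.

Lemma isometry_retraction_eq x y :
  S x -> d (psi x) y = 0%R -> isometry_retraction y = x.
Proof.
move=> Sx xy; have [Sr ry] : S (isometry_retraction y) /\
    d (psi (isometry_retraction y)) y = 0%R by apply: isometry_retractionP;
      exists x.
by apply: mdist_positivity; rewrite -iso// (pdist_eq0_eq _ ry) pdist_sym.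
Qed.

Lemma isometry_retractionK x : S x -> isometry_retraction (psi x) = x.
Proof. by move=> Sx; apply: isometry_retraction_eq => //; exact: pdistxx. Qed.

End retraction.

Lemma closed_saturated_image (Y : ptopologicalType) (d : pseudo_dist R Y)
    (S : set X) (psi : X -> Y) :
  metrized_by d -> closed S -> isometric_on d S psi ->
  closed (saturated_image d S psi).
Proof.
move=> dY cS iso; apply: (metrized_closed dY) => y cly.
have [x Sx xy] : exists2 x, S x &
    forall e : R, (0 < e)%R -> nbhs y [set z | (d (psi x) z < e)%R].
  apply: isometric_cauchy_limit => //.
    by move=> e e0; exists y; apply/dY; exists e.
  move=> A /dY[e e0 eA]; have [y' [x Sx xy'] yy'] := cly _ e0.
  by exists x => //; apply: eA;
    rewrite pdist_sym (pdist_eq0_eq _ xy') pdist_sym.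
exists x => //; apply/eqP; rewrite eq_le pdist_ge0 andbT.
apply/ler_addgt0Pl => e e0; rewrite addr0 ltW//.
exact: nbhs_singleton (xy _ e0).
Qed.

(** Closed sets are tested rather than open ones: the preimage of a closed [A] is the saturated
    image of [S]&[A], closed by completeness, together with the complement of the full saturated
    image when [A] contains the default value [point]. *)
Lemma measurable_isometry_retraction (Y : ptopologicalType) (d : pseudo_dist R Y)
    (S : set X) (psi : X -> Y) :
  metrized_by d -> closed S -> isometric_on d S psi ->
  measurable_fun setT (isometry_retraction d S psi : borel Y -> borel X).
Proof.
move=> dY cS iso; apply: borel_measurable_fun_closed => A cA.
have clE B : closed B -> B `<=` S -> closed (saturated_image d B psi).
  move=> cB BS; apply: closed_saturated_image => //.
  by move=> x x' /BS Sx /BS; exact: iso.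
have -> : isometry_retraction d S psi @^-1` A =
    saturated_image d (S `&` A) psi `|`
    (~` saturated_image d S psi `&` [set _ | A point]).
  apply/seteqP; split=> [y Ay|y [[x [Sx Ax] xy]|[Ey Ap]]].
  - have [Ey|Ey] := pselect (saturated_image d S psi y).
      left; have [Sr ry] := isometry_retractionP Ey.
      by exists (isometry_retraction d S psi y).
    right; split => //; move: Ay; rewrite /= /isometry_retraction xgetPN//.
    by move=> x [Sx xy]; apply: Ey; exists x.
  - by rewrite /preimage/= (isometry_retraction_eq iso Sx xy).
  - rewrite /preimage/= /isometry_retraction xgetPN//.
    by move=> x [Sx xy]; apply: Ey; exists x.
apply: measurableU.
  by apply: borel_closed; apply: clE; [exact: closedI|exact: subIsetl].
apply: measurableI.
  by apply: measurableC; apply: borel_closed; exact: clE.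
by have [Ap|Ap] := pselect (A point);
  [rewrite (_ : [set _ | _] = setT)|rewrite (_ : [set _ | _] = set0)];
  try (by apply/seteqP; split); [exact: measurableT|exact: measurable0].
Qed.

Lemma measurable_isometric_on (Y : ptopologicalType) (d : pseudo_dist R Y)
    (S : set X) (psi : X -> Y) (y0 : Y) :
  metrized_by d -> closed S -> isometric_on d S psi ->
  (forall x, ~ S x -> psi x = y0) ->
  measurable_fun setT (psi : borel X -> borel Y).
Proof.
move=> dY cS iso psi0; apply: borel_measurable_fun => A oA.
(* [psi] is controlled only on [S], so its preimage of [A] need not be open. [V] collects the balls
   of X around points of [S] whose counterparts around the image points lie in [A]; by isometry it
   agrees with the preimage on [S]. *)
pose V := \bigcup_(e in [set e : R * X | (0 < e.1)%R /\ S e.2 /\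
   forall z, (d (psi e.2) z < e.1)%R -> A z]) [set x | (mdist e.2 x < e.1)%R].
have oV : open V.
  apply: bigcup_open => -[e x] _ /=.
  exact: (metrized_open_ball (metrized_by_mdist (X := X))).
have -> : psi @^-1` A = (V `&` S) `|` (~` S `&` [set _ | A y0]).
  apply/seteqP; split=> [x Ax|x [[[[e z]/= [e0 [Sz zA]]] xz Sx]|[Sx Ay0]]].
  - have [Sx|Sx] := pselect (S x).
      left; split => //; have [e e0 eA] := (metrized_open dY A).1 oA _ Ax.
      by exists (e, x) => //=; rewrite mdistxx.
    by right; split => //; rewrite -(psi0 _ Sx).
  - by apply: zA; rewrite iso.
  - by rewrite /preimage/= psi0.
apply: measurableU.
  by apply: measurableI; [exact: borel_open|exact: borel_closed].
apply: measurableI.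
  by apply: measurableC; apply: borel_closed.
by have [Ap|Ap] := pselect (A y0);
  [rewrite (_ : [set _ | _] = setT)|rewrite (_ : [set _ | _] = set0)];
  try (by apply/seteqP; split); [exact: measurableT|exact: measurable0].
Qed.

End isometry.

(** * Consequences of separability *)

Section separable.
Context (R : realType).

Lemma separable_dense_seq (X : completeMetricType R) : separable X ->
  exists u : nat -> X, forall x (e : R), (0 < e)%R -> exists n, (mdist (u n) x < e)%R.
Proof.
move=> [S cS dS].
have [u su] : exists u : nat -> X, set_surj setT S u by apply/pcard_surjP.
exists u => x e e0.
have [||y [/= xy /su[n _ uy]]] := dS [set y | (mdist x y < e)%R].
- by exists x => /=; rewrite mdistxx.
- exact: (metrized_open_ball (metrized_by_mdist (X := X))).
- by exists n; rewrite uy metric_sym.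
Qed.

(** By separability an open set of the product is a countable union of products of balls, so
    measurability of the coordinates is enough for the Borel sigma-algebra of the product
    topology. *)
Lemma measurable_pair_borel d (T : measurableType d)
    (X1 X2 : completeMetricType R) (f1 : T -> X1) (f2 : T -> X2) :
  separable X1 -> separable X2 ->
  measurable_fun setT (f1 : T -> borel X1) ->
  measurable_fun setT (f2 : T -> borel X2) ->
  measurable_fun setT ((fun x => (f1 x, f2 x)) : T -> borel (X1 * X2)%type).
Proof.
move=> /separable_dense_seq[u1 u1P] /separable_dense_seq[u2 u2P] mf1 mf2.
apply: borel_measurable_fun => A oA.
pose B1 n k := [set x | (mdist (u1 n) x < k.+1%:R^-1)%R].
pose B2 n k := [set x | (mdist (u2 n) x < k.+1%:R^-1)%R].
pose P n m k := B1 n k `*` B2 m k `<=` A.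
have -> : (fun x => (f1 x, f2 x)) @^-1` A =
    \bigcup_n \bigcup_m \bigcup_(k in [set k | P n m k])
      (f1 @^-1` B1 n k `&` f2 @^-1` B2 m k).
  apply/seteqP; split=> [x /= Ax|x [n _ [m _ [k Pk [/= x1 x2]]]]];
    last exact: Pk.
  have [[U V] /= [/nbhs_ballP[e1 /= e10 eU] /nbhs_ballP[e2 /= e20 eV]] UVA] :
      nbhs (f1 x, f2 x) A by apply: open_nbhs_nbhs.
  pose e := Num.min e1 e2.
  have e0 : (0 < e / 2)%R by rewrite divr_gt0// lt_min e10.
  (* A ball of radius less than [e / 2] around a dense point that contains [f1 x] lies within [e] of
     [f1 x]; the same [k] serves both coordinates. *)
  have [k ke] : exists k : nat, (k.+1%:R^-1 < e / 2)%R.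
    by have [k _ /(_ k (leqnn k))] := near_infty_natSinv_lt (PosNum e0);
      exists k.
  have k0 : (0 < k.+1%:R^-1 :> R)%R by rewrite invr_gt0.
  have [n nx] := u1P (f1 x) _ k0; have [m mx] := u2P (f2 x) _ k0.
  exists n => //; exists m => //; exists k => //= -[y1 y2] [/= y1n y2m].
  apply: UVA; split => /=; [apply: eU|apply: eV]; rewrite ballEmdist/=.
  - rewrite (le_lt_trans (metric_triangle _ (u1 n) _))// (metric_sym (f1 x)).
    rewrite (lt_le_trans (ltrD nx y1n))// (le_trans (ltW (ltrD ke ke)))//.
    by rewrite -splitr ge_min lexx.
  - rewrite (le_lt_trans (metric_triangle _ (u2 m) _))// (metric_sym (f2 x)).
    rewrite (lt_le_trans (ltrD mx y2m))// (le_trans (ltW (ltrD ke ke)))//.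
    by rewrite -splitr ge_min lexx orbT.
have mB1 n k : measurable (f1 @^-1` B1 n k).
  rewrite -[X in measurable X]setTI; apply: mf1 => //; apply: borel_open.
  exact: (metrized_open_ball (metrized_by_mdist (X := X1))).
have mB2 n k : measurable (f2 @^-1` B2 n k).
  rewrite -[X in measurable X]setTI; apply: mf2 => //; apply: borel_open.
  exact: (metrized_open_ball (metrized_by_mdist (X := X2))).
apply: bigcupT_measurable => n; apply: bigcupT_measurable => m.
by apply: bigcup_measurable => k _; exact: measurableI.
Qed.

Lemma support_closed (X : ptopologicalType) (mu : set (borel X) -> \bar R) :
  closed (Defs.support mu).
Proof.
move=> x clx U xU; have [oU Ux] := xU.
have [y [yS Uy]] := clx U (open_nbhs_nbhs xU).
exact: yS.
Qed.

(** Every point outside the support lies in a null ball with dense centre and radius [k.+1%:R^-1],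
    and there are countably many such balls. Balls of positive measure are replaced by the empty set
    in [C]. *)
Lemma support_compl_null (X : completeMetricType R) (mu : fmeas R X) :
  separable X -> mu (~` Defs.support mu) = 0.
Proof.
move=> /separable_dense_seq[u uP].
pose B n k := [set x | (mdist (u n) x < k.+1%:R^-1)%R].
pose C n k := if mu (B n k) == 0 then B n k else set0.
have oB n k : open (B n k).
  exact: (metrized_open_ball (metrized_by_mdist (X := X))).
have : mu.-negligible (\bigcup_n \bigcup_k C n k).
  apply: negligible_bigcup => n; apply: negligible_bigcup => k.
  rewrite /C; case: ifPn => [/eqP B0|_]; last exact: negligible_set0.
  by exists (B n k); split => //; exact: borel_open.
move=> [N [mN N0 CN]]; apply/eqP; rewrite -measure_le0 -N0 le_measure ?inE//.
  by apply: measurableC; apply: borel_closed; exact: support_closed.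
apply: subset_trans CN => x /= /existsNP[U /not_implyP[[oU Ux] /negP]].
rewrite -leNgt => U0.
have [e e0 eU] := (metrized_open (metrized_by_mdist (X := X)) U).1 oU _ Ux.
have e20 : (0 < e / 2)%R by rewrite divr_gt0.
have [k ke] : exists k : nat, (k.+1%:R^-1 < e / 2)%R.
  by have [k _ /(_ k (leqnn k))] := near_infty_natSinv_lt (PosNum e20);
    exists k.
have k0 : (0 < k.+1%:R^-1 :> R)%R by rewrite invr_gt0.
have [n nx] := uP x _ k0.
exists n => //; exists k => //; rewrite /C ifT//.
rewrite -measure_le0 (le_trans _ U0)// le_measure ?inE//.
- exact: borel_open.
- exact: borel_open.
- move=> y /= ny; apply: eU;
  rewrite (le_lt_trans (metric_triangle _ (u n) _))//.
  rewrite (metric_sym x) (lt_le_trans (ltrD nx ny))// (le_trans (ltW (ltrD ke ke)))//.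
  by rewrite -splitr.
Qed.

End separable.

(** * Transfer of plans between X1 x X2 and Y x Y *)

Section transport.
Context (R : realType) (F l : R -> \bar R).
Hypothesis F0 : forall s : R, (0 <= s)%R -> 0 <= F s.
Hypothesis mF : measurable_fun (`[0%R, +oo[%classic : set R) F.
Hypothesis Foo : superlinear F.
Hypothesis l0 : forall s : R, (0 <= s)%R -> 0 <= l s.
Hypothesis ml : measurable_fun (`[0%R, +oo[%classic : set R) l.

Lemma measurable_cost (Y : ptopologicalType) (d : pseudo_dist R Y) :
  metrized_by d ->
  measurable_fun setT (fun z : borel (Y * Y)%type => l (d z.1 z.2)).
Proof.
move=> dY; apply: (measurable_entropy ml (measurable_dist dY)) => z.
exact: pdist_ge0.
Qed.

Context (X1 X2 : completeMetricType R).

Lemma continuous_prod_map (Y : ptopologicalType) (psi1 : X1 -> Y) (psi2 : X2 -> Y) :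
  continuous psi1 -> continuous psi2 ->
  continuous ((fun z => (psi1 z.1, psi2 z.2)) : X1 * X2 -> Y * Y).
Proof.
move=> c1 c2 [x y]; apply: cvg_pair => /=.
  by apply: (@cvg_comp _ _ _ fst psi1); [exact: cvg_fst|exact: c1].
by apply: (@cvg_comp _ _ _ snd psi2); [exact: cvg_snd|exact: c2].
Qed.

Lemma isometric_continuous (X : completeMetricType R) (Y : ptopologicalType)
    (d : pseudo_dist R Y) (psi : X -> Y) :
  metrized_by d -> isometric_on d setT psi -> continuous psi.
Proof.
move=> dY iso x A /dY[e e0 eA].
by apply/(metrized_by_mdist (X := X)); exists e => // y xy; apply: eA;
  rewrite iso.
Qed.

Lemma measurable_coupling_cost (d : pseudo_dist R (X1 + X2)%type) : pm_coupling d ->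
  measurable_fun setT (fun z : borel (X1 * X2)%type => l (d (inl z.1) (inr z.2))).
Proof.
move=> [d1 d2]; have dY := @metrized_by_pspace R _ d.
pose f z : pspace d * pspace d := (inl z.1 : pspace d, inr z.2 : pspace d).
have mf : measurable_fun setT (f : borel (X1 * X2)%type -> borel (pspace d * pspace d)%type).
  apply: continuous_borel; apply: continuous_prod_map.
    by apply: (isometric_continuous dY) => x y _ _; exact: d1.
  by apply: (isometric_continuous dY) => x y _ _; exact: d2.
exact: (measurableT_comp (measurable_cost dY) mf).
Qed.

Variables (mu1 : fmeas R X1) (mu2 : fmeas R X2).

Definition coupling_cost (gamma : fmeas R (X1 * X2)%type)
    (d : pseudo_dist R (X1 + X2)%type) :=
  F_divergence F (pushforward gamma (fst : borel (X1 * X2)%type -> borel X1)) mu1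
  + F_divergence F (pushforward gamma (snd : borel (X1 * X2)%type -> borel X2)) mu2
  + \int[gamma]_z l (d (inl z.1) (inr z.2)).

Section comparison.
Context (Y : ptopologicalType) (dY : pseudo_dist R Y).
Hypothesis metY : metrized_by dY.
Variables (psi1 : X1 -> Y) (psi2 : X2 -> Y) (nu1 nu2 : set (borel Y) -> \bar R).
Hypothesis mpsi1 : measurable_fun setT (psi1 : borel X1 -> borel Y).
Hypothesis mpsi2 : measurable_fun setT (psi2 : borel X2 -> borel Y).
Hypothesis nu1E : forall A, measurable A -> nu1 A = mu1 (psi1 @^-1` A).
Hypothesis nu2E : forall A, measurable A -> nu2 A = mu2 (psi2 @^-1` A).
Variable d : pseudo_dist R (X1 + X2)%type.

(** The plan is pushed forward by [psi1] and [psi2] coordinatewise. Its marginals are the images of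
    those of [gamma], and the isometries have Borel left inverses, so no entropy is gained; the
    transport term is unchanged by [dE]. *)
Lemma entropy_transport_le_coupling_cost (gamma : fmeas R (X1 * X2)%type) :
  isometric_on dY setT psi1 -> isometric_on dY setT psi2 ->
  (forall x y, d (inl x) (inr y) = dY (psi1 x) (psi2 y)) ->
  entropy_transport F (fun x y => l (dY x y)) nu1 nu2 <= coupling_cost gamma d.
Proof.
move=> iso1 iso2 dE.
pose f z := (psi1 z.1, psi2 z.2).
have mf : measurable_fun setT (f : borel (X1 * X2)%type -> borel (Y * Y)%type).
  by apply: continuous_borel; apply: continuous_prod_map;
    exact: isometric_continuous.
apply: (@le_trans _ _ (
    F_divergence F (pushforward (image_measure gamma mf)
      (fst : borel (Y * Y)%type -> borel Y)) nu1
    + F_divergence F (pushforward (image_measure gamma mf)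
      (snd : borel (Y * Y)%type -> borel Y)) nu2
    + \int[image_measure gamma mf]_z l (dY z.1 z.2))).
  by apply: ereal_inf_lbound; exists (image_measure gamma mf).
have mr1 : measurable_fun setT (isometry_retraction dY setT psi1 : borel Y -> borel X1).
  by apply: measurable_isometry_retraction => //; exact: closedT.
have mr2 : measurable_fun setT (isometry_retraction dY setT psi2 : borel Y -> borel X2).
  by apply: measurable_isometry_retraction => //; exact: closedT.
rewrite /coupling_cost; apply: leeD; [apply: leeD|].
(* [nu1] is only a set function; on Borel sets it agrees with the image of [mu1], and [F_divergence]
   sees nothing else. *)
- rewrite (@eq_F_divergence _ _ _ F _
    (image_measure (image_measure gamma (@fst_borel X1 X2)) mpsi1) nu1
    (image_measure mu1 mpsi1))//.
  apply: (F_divergence_section F0 mF Foo mu1 mpsi1 mr1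
    (image_measure gamma (@fst_borel X1 X2))).
  by move=> x; exact: isometry_retractionK.
- rewrite (@eq_F_divergence _ _ _ F _
    (image_measure (image_measure gamma (@snd_borel X1 X2)) mpsi2) nu2
    (image_measure mu2 mpsi2))//.
  apply: (F_divergence_section F0 mF Foo mu2 mpsi2 mr2
    (image_measure gamma (@snd_borel X1 X2))).
  by move=> x; exact: isometry_retractionK.
- rewrite ge0_integral_image_measure//; first last.
  + by move=> z _; apply: l0; exact: pdist_ge0.
  + exact: measurable_cost.
  rewrite preimage_setT (eq_integral
    (fun z : borel (X1 * X2)%type => l (d (inl z.1) (inr z.2))))//.
  by move=> z _ /=; rewrite dE.
Qed.

(** Finite divergence makes [g] absolutely continuous with respect to the image of [mu], which does
    not charge the complement because [psi] sends [S] into the saturated image. *)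
Lemma divergence_null_compl (X : completeMetricType R) (mu : fmeas R X)
    (psi : X -> Y) (S : set X) (g : {finite_measure set (borel Y) -> \bar R})
    (mpsi : measurable_fun setT (psi : borel X -> borel Y)) :
  closed S -> mu (~` S) = 0 -> isometric_on dY S psi ->
  F_divergence F g (image_measure mu mpsi) < +oo ->
  g (~` saturated_image dY S psi) = 0.
Proof.
move=> cS S0 iso /(F_divergence_finite_density F0 Foo)[s [ms s0 gs]].
have mE : measurable (~` saturated_image dY S psi : set (borel Y)).
  by apply: measurableC; apply: borel_closed; exact: closed_saturated_image.
rewrite gs//; apply: null_set_integral => //.
  by apply: measurable_funTS; exact/measurable_EFinP.
transitivity (mu (psi @^-1` (~` saturated_image dY S psi))) => //.
apply/eqP; rewrite -measure_le0 -S0 le_measure ?inE//.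
- by rewrite -[X in measurable X]setTI; exact: (mpsi measurableT _ mE).
- by apply: measurableC; exact: borel_closed.
- move=> x Ex Sx; apply: Ex; exists x => //; exact: pdistxx.
Qed.

Lemma coupling_cost_le_transport (S1 : set X1) (S2 : set X2)
    (gamma : fmeas R (Y * Y)%type) :
  separable X1 -> separable X2 ->
  closed S1 -> closed S2 -> mu1 (~` S1) = 0 -> mu2 (~` S2) = 0 ->
  isometric_on dY S1 psi1 -> isometric_on dY S2 psi2 ->
  pm_coupling d ->
  (forall x y, S1 x -> S2 y -> d (inl x) (inr y) = dY (psi1 x) (psi2 y)) ->
  exists gamma' : fmeas R (X1 * X2)%type, coupling_cost gamma' d <=
    F_divergence F (pushforward gamma (fst : borel (Y * Y)%type -> borel Y)) nu1
    + F_divergence F (pushforward gamma (snd : borel (Y * Y)%type -> borel Y)) nu2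
    + \int[gamma]_z l (dY z.1 z.2).
Proof.
move=> sep1 sep2 cS1 cS2 S10 S20 iso1 iso2 dcoupl dE.
set r1 := isometry_retraction dY S1 psi1;
  set r2 := isometry_retraction dY S2 psi2.
have mr1 : measurable_fun setT (r1 : borel Y -> borel X1).
  exact: measurable_isometry_retraction.
have mr2 : measurable_fun setT (r2 : borel Y -> borel X2).
  exact: measurable_isometry_retraction.
have mr : measurable_fun setT
    ((fun z => (r1 z.1, r2 z.2)) : borel (Y * Y)%type -> borel (X1 * X2)%type).
  apply: measurable_pair_borel => //.
    exact: (measurableT_comp mr1 (@fst_borel Y Y)).
  exact: (measurableT_comp mr2 (@snd_borel Y Y)).
pose g1 := image_measure gamma (@fst_borel Y Y).
pose g2 := image_measure gamma (@snd_borel Y Y).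
rewrite (@eq_F_divergence _ _ _ F _ g1 nu1 (image_measure mu1 mpsi1))//.
rewrite (@eq_F_divergence _ _ _ F _ g2 nu2 (image_measure mu2 mpsi2))//.
have D10 := F_divergence_ge0 F0 Foo (image_measure mu1 mpsi1) g1.
have D20 := F_divergence_ge0 F0 Foo (image_measure mu2 mpsi2) g2.
have I0 : 0 <= \int[gamma]_z l (dY z.1 z.2).
  by apply: integral_ge0 => z _; apply: l0; exact: pdist_ge0.
exists (image_measure gamma mr).
(* An infinite divergence makes the right-hand side [+oo], the other terms being nonnegative.
   Finiteness is then what confines both marginals to the saturated images. *)
have [D1|D1] := eqVneq (F_divergence F g1 (image_measure mu1 mpsi1)) +oo.
  by rewrite D1 addye ?gt_eqF ?(lt_le_trans _ D20)// addye ?leey// gt_eqF// (lt_le_trans _ I0).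
have [D2|D2] := eqVneq (F_divergence F g2 (image_measure mu2 mpsi2)) +oo.
  by rewrite D2 addey ?gt_eqF ?(lt_le_trans _ D10)// addye ?leey// gt_eqF// (lt_le_trans _ I0).
have E1 : g1 (~` saturated_image dY S1 psi1) = 0.
  by apply: (divergence_null_compl cS1 S10 iso1); rewrite ltey; exact: D1.
have E2 : g2 (~` saturated_image dY S2 psi2) = 0.
  by apply: (divergence_null_compl cS2 S20 iso2); rewrite ltey; exact: D2.
rewrite /coupling_cost; apply: leeD; [apply: leeD|].
- apply: (F_divergence_retraction F0 mF Foo mpsi1 mr1 g1 (S := S1)) => //.
    exact: borel_closed.
  by move=> x Sx; exact: isometry_retractionK.
- apply: (F_divergence_retraction F0 mF Foo mpsi2 mr2 g2 (S := S2)) => //.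
    exact: borel_closed.
  by move=> x Sx; exact: isometry_retractionK.
rewrite ge0_integral_image_measure//; first last.
- by move=> z _; apply: l0; exact: pdist_ge0.
- exact: measurable_coupling_cost.
rewrite preimage_setT le_eqVlt; apply/orP; left; apply/eqP.
apply: ge0_ae_eq_integral => //.
- exact: (measurableT_comp (measurable_coupling_cost dcoupl) mr).
- exact: measurable_cost.
- by move=> z _; apply: l0; exact: pdist_ge0.
- by move=> z _; apply: l0; exact: pdist_ge0.
have mE1 : measurable (~` saturated_image dY S1 psi1 : set (borel Y)).
  by apply: measurableC; apply: borel_closed; exact: closed_saturated_image.
have mE2 : measurable (~` saturated_image dY S2 psi2 : set (borel Y)).
  by apply: measurableC; apply: borel_closed; exact: closed_saturated_image.
have mN1 : measurable
    ((fst : borel (Y * Y)%type -> borel Y) @^-1` (~` saturated_image dY S1 psi1)).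
  by rewrite -[X in measurable X]setTI; exact: fst_borel.
have mN2 : measurable
    ((snd : borel (Y * Y)%type -> borel Y) @^-1` (~` saturated_image dY S2 psi2)).
  by rewrite -[X in measurable X]setTI; exact: snd_borel.
have : gamma.-negligible
  ((fst : borel (Y * Y)%type -> borel Y) @^-1` (~` saturated_image dY S1 psi1) `|`
  (snd : borel (Y * Y)%type -> borel Y) @^-1` (~` saturated_image dY S2 psi2)).
  apply: negligibleU; apply/negligibleP => //.
apply: negligibleS => -[y1 y2] /= H;
  apply: contrapT => /not_orP[/contrapT N1 /contrapT N2].
apply: H => _ /=.
have [Sr1 ry1] := isometry_retractionP N1.
have [Sr2 ry2] := isometry_retractionP N2.
(* Each [y] is at distance zero from the image of its retraction, so replacing one by the other does
   not change the cost. *)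
rewrite dE// (pdist_eq0_eq _ ry1) pdist_sym (pdist_eq0_eq _ ry2).
by rewrite pdist_sym.
Qed.

End comparison.
End transport.

(** * The metric quotient of a complete pseudo-metric space *)

Section metric_quotient.
Local Open Scope quotient_scope.
Context (R : realType) (T : pointedType) (d : pseudo_dist R T).

(** Phrased with [d] alone, so that it applies to X1 + X2 without choosing a topology there. *)
Definition cauchy_complete := forall G : set_system T, ProperFilter G ->
  (forall e : R, (0 < e)%R -> exists y, G [set z | (d y z < e)%R]) ->
  exists x, forall e : R, (0 < e)%R -> G [set z | (d x z < e)%R].

Definition dist0 : rel T := fun x y => d x y == 0%R.

Let dist0_refl : reflexive dist0. Proof. by move=> x; rewrite /dist0 pdistxx. Qed.

Let dist0_sym : symmetric dist0.
Proof. by move=> x y; rewrite /dist0 pdist_sym. Qed.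

Let dist0_trans : transitive dist0.
Proof.
by move=> y x z; rewrite /dist0 => /eqP/(pdist_eq0_eq z) ->.
Qed.

Canonical dist0_equiv := EquivRel dist0 dist0_refl dist0_sym dist0_trans.

(** The completeness proof is part of the type, which lets the quotient carry a canonical structure
    of complete metric space. *)
Definition metric_quotient of cauchy_complete : Type := {eq_quot dist0}.

Variable dc : cauchy_complete.
Local Notation Q := (metric_quotient dc).

HB.instance Definition _ := Choice.on Q.
HB.instance Definition _ := isPointed.Build Q (\pi_{eq_quot dist0} point).

Definition to_quotient (x : T) : Q := \pi_{eq_quot dist0} x.

Let rep (q : Q) : T := repr (q : {eq_quot dist0}).

Lemma rep_to_quotient x : d (rep (to_quotient x)) x = 0%R.
Proof. by apply/eqP; have /eqmodP := reprK (to_quotient x : {eq_quot dist0}). Qed.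

Let qdist (p q : Q) : R := d (rep p) (rep q).

Let qdistxx p : qdist p p = 0%R. Proof. exact: pdistxx. Qed.

Let qdist_positivity p q : qdist p q = 0%R -> p = q.
Proof.
move=> /eqP pq; rewrite -(reprK (p : {eq_quot dist0})) -(reprK (q : {eq_quot dist0})).
exact/eqmodP.
Qed.

Let qdist_sym p q : qdist p q = qdist q p. Proof. exact: pdist_sym. Qed.

Let qdist_triangle q p r : (qdist p r <= qdist p q + qdist q r)%R.
Proof. exact: pdist_triangle. Qed.

HB.instance Definition _ := isMetric.Build R Q
  qdistxx qdist_positivity qdist_sym qdist_triangle.

Lemma mdist_to_quotient x y : mdist (to_quotient x) (to_quotient y) = d x y.
Proof.
rewrite [LHS](pdist_eq0_eq _ (rep_to_quotient x)) pdist_sym.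
by rewrite (pdist_eq0_eq _ (rep_to_quotient y)) pdist_sym.
Qed.

Let to_quotientK (q : Q) : to_quotient (rep q) = q.
Proof. exact: (reprK (q : {eq_quot dist0})). Qed.

Let quotient_complete (G : set_system Q) : ProperFilter G -> cauchy G -> cvg G.
Proof.
move=> GG /cauchyP cG.
have [] := dc (G := fmap rep G).
  move=> e e0; have [p Gp] := cG e e0.
  exists (rep p); move: Gp; apply: (@filterS Q G) => q.
  by rewrite ballEmdist.
move=> x Gx; apply/cvg_ex; exists (to_quotient x); apply/fcvg_ballP => e e0.
move: (Gx e e0); apply: (@filterS Q G) => q /=; rewrite ballEmdist /= => xq.
by rewrite -(to_quotientK q) mdist_to_quotient.
Qed.

HB.instance Definition _ := Uniform_isComplete.Build Q quotient_complete.

Lemma to_quotient_surj (q : Q) : exists x, q = to_quotient x.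
Proof. by exists (rep q). Qed.
End metric_quotient.

Lemma lower_semicontinuous_subspace_measurable (R : realType) (D : set R) (f : R -> \bar R) :
  measurable D -> lower_semicontinuous (f : subspace D -> \bar R) -> measurable_fun D f.
Proof.
move=> mD /lower_semicontinuousP scf.
apply: (measurability _ (ErealGenOInfty.measurableE R)).
move=> /= _ [_ [a ->]] <-; apply: open_measurable_subspace => //.
by rewrite preimage_itvoy; exact: scf.
Qed.

Lemma continuous_lower_semicontinuous (R : realType) (T : topologicalType) (f : T -> \bar R) :
  continuous f -> lower_semicontinuous f.
Proof.
move=> /continuousP cf; apply/lower_semicontinuousP => a.
exact: (cf _ (@open_ereal_gt_ereal R a%:E)).
Qed.

(** [A] will hold transport costs and [B] coupling costs. A transport cost is itself an infimum over
    plans, so it is bounded below by the infimum of [B] and not by a single element; this explains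
    the asymmetric hypotheses. *)
Lemma ereal_inf_poweR (R : realType) (a : R) (A B : set (\bar R)) :
  (0 < a)%R -> (forall x, B x -> 0 <= x) ->
  (forall x, A x -> ereal_inf B <= x) ->
  (forall y, B y -> exists2 x, A x & x <= y) ->
  ereal_inf [set x `^ a | x in A] = ereal_inf B `^ a.
Proof.
move=> a0 B0 AB BA.
have infB0 : 0 <= ereal_inf B by exact: le_ereal_inf_tmp.
have A0 x : A x -> 0 <= x by move=> /AB; exact: le_trans.
have mono r (x y : \bar R) : (0 < r)%R -> 0 <= x -> x <= y -> x `^ r <= y `^ r.
  move=> r0 x0 xy; apply: gt0_ler_poweR => //; first exact: ltW.
    by rewrite in_itv/= x0 leey.
  by rewrite in_itv/= (le_trans x0 xy) leey.
apply/eqP; rewrite eq_le; apply/andP; split; last first.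
  apply: le_ereal_inf_tmp => _ [x Ax <-]; apply: (mono a) => //.
  exact: AB.
set S := leLHS.
have S0 : 0 <= S by apply: le_ereal_inf_tmp => _ [x Ax <-]; exact: poweR_ge0.
have SK (x : \bar R) : 0 <= x -> (x `^ a) `^ a^-1 = x.
  by move=> x0; rewrite -poweRrM divff ?gt_eqF// poweRe1.
have SK' (x : \bar R) : 0 <= x -> (x `^ a^-1) `^ a = x.
  by move=> x0; rewrite -poweRrM mulVf ?gt_eqF// poweRe1.
(* Writing [S] as the power [a] of its power [a^-1] reduces the bound to one without exponent on the
   right. *)
rewrite -(SK' S)//; apply: (mono a) => //; first exact: poweR_ge0.
apply: le_ereal_inf_tmp => y By; have [x Ax xy] := BA y By.
rewrite (le_trans _ xy)// -(SK x (A0 _ Ax)); apply: (mono a^-1%R);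
  rewrite ?invr_gt0//.
by apply: ereal_inf_lbound; exists x.
Qed.

(** * Pseudo-metric couplings: completeness, separability and gluing *)

Section coupling.
Context (R : realType) (X1 X2 : completeMetricType R).

Lemma pm_coupling_complete (d : pseudo_dist R (X1 + X2)%type) :
  pm_coupling d -> cauchy_complete d.
Proof.
move=> [d1 d2] G GG cG.
have [GS|] := pselect (forall A, G A -> exists2 x, setT x & A (inl x)).
  have iso1 : isometric_on d setT (inl : X1 -> X1 + X2) by move=> x x' _ _;
    exact: d1.
  have [x _ Gx] := isometric_cauchy_limit GG closedT iso1 cG GS.
  by exists (inl x).
move=> /existsNP[A /not_implyP[GA AN]].
have iso2 : isometric_on d setT (inr : X2 -> X1 + X2) by move=> x x' _ _;
  exact: d2.
have [|x _ Gx] := isometric_cauchy_limit GG closedT iso2 cG;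
  last by exists (inr x).
(* Some [A] in [G] misses X1, so every [B] in [G] meets [A] inside X2. *)
move=> B GB; have [[x|y] [Az Bz]] := filter_ex (filterI GA GB).
  by exfalso; apply: AN; exists x.
by exists y.
Qed.

Lemma separable_coupling_quotient (d : pseudo_dist R (X1 + X2)%type)
    (dc : pm_coupling d) :
  separable X1 -> separable X2 -> separable (metric_quotient (pm_coupling_complete dc)).
Proof.
move=> /separable_dense_seq[u1 u1P] /separable_dense_seq[u2 u2P].
set Y := metric_quotient _.
pose v (k : nat + nat) : Y :=
  match k with
  | inl n => to_quotient _ (inl (u1 n))
  | inr n => to_quotient _ (inr (u2 n))
  end.
exists (range v).
  by apply: (sub_countable (card_image_le _ _)); exact: countableP.
move=> O [q Oq] /(metrized_open (metrized_by_mdist (X := Y))) /(_ _ Oq)[e e0 eO].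
have [[x|y] qE] := to_quotient_surj q.
- have [n nx] := u1P x _ e0; exists (v (inl n)); split; last by exists (inl n).
  apply: eO; rewrite qE /=.
  have -> : mdist (to_quotient (pm_coupling_complete dc) (inl x)) (v (inl n)) =
      d (inl x) (inl (u1 n)).
    exact: mdist_to_quotient.
  by rewrite dc.1 metric_sym.
- have [n nx] := u2P y _ e0; exists (v (inr n)); split; last by exists (inr n).
  apply: eO; rewrite qE /=.
  have -> : mdist (to_quotient (pm_coupling_complete dc) (inr y)) (v (inr n)) =
      d (inr y) (inr (u2 n)).
    exact: mdist_to_quotient.
  by rewrite dc.2 metric_sym.
Qed.

Section gluing.
Context (Y : Type) (dY : pseudo_dist R Y).
Variables (S1 : set X1) (S2 : set X2) (psi1 : X1 -> Y) (psi2 : X2 -> Y).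
Hypotheses (S10 : S1 !=set0) (S20 : S2 !=set0).
Hypotheses (iso1 : isometric_on dY S1 psi1) (iso2 : isometric_on dY S2 psi2).

Let paths (x : X1) (y : X2) : set R :=
  [set (mdist x p.1 + dY (psi1 p.1) (psi2 p.2) + mdist p.2 y)%R
     | p in [set p : X1 * X2 | S1 p.1 /\ S2 p.2]].

Let h (x : X1) (y : X2) : R := inf (paths x y).

Let h_le x y s t : S1 s -> S2 t ->
  (h x y <= mdist x s + dY (psi1 s) (psi2 t) + mdist t y)%R.
Proof.
move=> Ss St; apply: ge_inf; last by exists (s, t).
by exists 0%R => _ [[s' t'] _ <-] /=; rewrite !addr_ge0// ?mdist_ge0 ?pdist_ge0.
Qed.

Let le_h x y c : (forall s t, S1 s -> S2 t ->
  c <= mdist x s + dY (psi1 s) (psi2 t) + mdist t y)%R -> (c <= h x y)%R.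
Proof.
(* Nonemptiness of [S1] and [S2] matters here: the real [inf] of an empty set is a default value
   that need not exceed [c]. *)
move=> H; apply: lb_le_inf; last by move=> _ [[s t] [/= Ss St] <-]; exact: H.
have [s Ss] := S10; have [t St] := S20.
by exists (mdist x s + dY (psi1 s) (psi2 t) + mdist t y)%R, (s, t).
Qed.

Let glue (z w : X1 + X2) : R :=
  match z, w with
  | inl x, inl x' => mdist x x'
  | inr y, inr y' => mdist y y'
  | inl x, inr y => h x y
  | inr y, inl x => h x y
  end.

Let gluexx z : glue z z = 0%R. Proof. by case: z => x; exact: mdistxx. Qed.

Let glue_sym z w : glue z w = glue w z.
Proof. by case: z w => x [y|y] //=; exact: metric_sym. Qed.

Let h_triangle1 x x' y : (h x y <= mdist x x' + h x' y)%R.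
Proof.
rewrite -lerBlDl; apply: le_h => s t Ss St.
by have := h_le x y Ss St; have := metric_triangle x x' s; lra.
Qed.

Let h_triangle2 x y y' : (h x y <= h x y' + mdist y' y)%R.
Proof.
rewrite -lerBlDr; apply: le_h => s t Ss St.
by have := h_le x y Ss St; have := metric_triangle t y' y; lra.
Qed.

Let h_triangle3 x x' y : (mdist x x' <= h x y + h x' y)%R.
Proof.
rewrite -lerBlDr; apply: le_h => s t Ss St.
(* Two paths to [y], through [(s, t)] and [(s', t')], are compared. The distance from [s] to [s'] is
   computed in Y and detours through the images of [t] and [t'], whose distance is bounded through
   [y]; both isometries are used. *)
rewrite lerBlDl -lerBlDr; apply: le_h => s' t' Ss' St'.
have h1 := metric_triangle x s x'; have h2 := metric_triangle s s' x'.
have h3 := pdist_triangle dY (psi2 t) (psi1 s) (psi1 s').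
have h4 := pdist_triangle dY (psi2 t') (psi2 t) (psi1 s').
have h5 := metric_triangle t y t'.
rewrite iso1// in h3; rewrite iso2// (pdist_sym dY (psi2 t') (psi1 s')) in h4.
rewrite (metric_sym y t') in h5; rewrite (metric_sym s' x') in h2.
by lra.
Qed.

Let h_triangle4 x y y' : (mdist y y' <= h x y + h x y')%R.
Proof.
rewrite -lerBlDr; apply: le_h => s t Ss St.
rewrite lerBlDl -lerBlDr; apply: le_h => s' t' Ss' St'.
have h1 := metric_triangle y t y'; have h2 := metric_triangle t t' y'.
have h3 := pdist_triangle dY (psi1 s) (psi2 t) (psi2 t').
have h4 := pdist_triangle dY (psi1 s') (psi1 s) (psi2 t').
have h5 := metric_triangle s x s'.
rewrite iso2// (pdist_sym dY (psi2 t) (psi1 s)) in h3; rewrite iso1// in h4.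
rewrite (metric_sym s x) in h5; rewrite (metric_sym y t) in h1.
by lra.
Qed.

Let glue_triangle w z v : (glue z v <= glue z w + glue w v)%R.
Proof.
case: z w v => [x|y] [x'|y'] [x''|y''] /=; do ?exact: metric_triangle.
- exact: h_triangle1.
- exact: h_triangle3.
- exact: h_triangle2.
- by rewrite addrC metric_sym; exact: h_triangle1.
- exact: h_triangle4.
- by rewrite addrC metric_sym; exact: h_triangle2.
Qed.

Lemma coupling_gluing_nonempty : exists2 d : pseudo_dist R (X1 + X2)%type,
  pm_coupling d &
  forall x y, S1 x -> S2 y -> d (inl x) (inr y) = dY (psi1 x) (psi2 y).
Proof.
exists (PseudoDist gluexx glue_sym glue_triangle) => // x y Sx Sy.
transitivity (h x y) => //; apply/eqP; rewrite eq_le; apply/andP; split.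
  by have := h_le x y Sx Sy; rewrite !mdistxx add0r addr0.
(* The path with [s = x] and [t = y] gave the upper bound; any other path is no shorter, since its
   outer legs can be measured in Y. *)
apply: le_h => s t Ss St; rewrite -iso1// -iso2//.
have h1 := pdist_triangle dY (psi1 s) (psi1 x) (psi2 y).
have h2 := pdist_triangle dY (psi2 t) (psi1 s) (psi2 y).
by lra.
Qed.
End gluing.

(** The case of an empty set does occur: the zero measure has empty support. *)
Lemma coupling_gluing (Y : pointedType) (dY : pseudo_dist R Y)
    (S1 : set X1) (S2 : set X2) (psi1 : X1 -> Y) (psi2 : X2 -> Y) :
  isometric_on dY S1 psi1 -> isometric_on dY S2 psi2 ->
  exists2 d : pseudo_dist R (X1 + X2)%type, pm_coupling d &
  forall x y, S1 x -> S2 y -> d (inl x) (inr y) = dY (psi1 x) (psi2 y).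
Proof.
move=> iso1 iso2.
(* If S1 or S2 is empty there is nothing to respect: glue along base points. *)
have [[S10 S20]|N] := pselect (S1 !=set0 /\ S2 !=set0).
  exact: coupling_gluing_nonempty.
have iso1' : isometric_on dY [set point] (fun _ : X1 => point).
  by move=> x x' -> ->; rewrite pdistxx mdistxx.
have iso2' : isometric_on dY [set point] (fun _ : X2 => point).
  by move=> x x' -> ->; rewrite pdistxx mdistxx.
have [||d dc _] := coupling_gluing_nonempty _ _ iso1' iso2';
  [by exists point..|].
by exists d => // x y Sx Sy; exfalso; apply: N; split; [exists x|exists y].
Qed.

End coupling.

(** Identifies the set function [push_support psi] on Borel sets with the image of [mu] under any
    Borel extension of [psi]: the two preimages differ off the support only, which is null. *)
Lemma push_supportE (R : realType) (X : completeMetricType R) (Y : ptopologicalType)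
    (mu : fmeas R X) (psi : Defs.support mu -> Y) (psi' : X -> Y) A :
  separable X -> measurable_fun setT (psi' : borel X -> borel Y) ->
  (forall x, psi' (set_val x) = psi x) -> measurable A ->
  push_support psi A = mu (psi' @^-1` A).
Proof.
move=> sep mpsi psiE mA.
have mB : measurable (psi' @^-1` A : set (borel X)).
  by rewrite -[X in measurable X]setTI; exact: (mpsi measurableT _ mA).
have mS : measurable (Defs.support mu : set (borel X)).
  by apply: borel_closed; exact: support_closed.
transitivity (mu (psi' @^-1` A `&` Defs.support mu)).
  rewrite /push_support; congr (mu _); apply/seteqP;
    split=> [_ [x Ax <-]|x [Ax Sx]].
    by split; [rewrite /preimage/= psiE|exact: set_valP].
  by exists (SigSub (mem_set Sx)) => //; rewrite /preimage/= -psiE.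
have -> : mu (psi' @^-1` A) =
    mu (psi' @^-1` A `&` Defs.support mu) + mu (psi' @^-1` A `&` ~` Defs.support mu).
  rewrite -measureU//.
  - by rewrite -setIUr setUv setIT.
  - exact: measurableI.
  - by apply: measurableI => //; exact: measurableC.
  - by rewrite setIACA setICr setI0.
suff -> : mu (psi' @^-1` A `&` ~` Defs.support mu) = 0 by rewrite adde0.
apply/eqP; rewrite -measure_le0 -(support_compl_null mu sep) le_measure ?inE//.
- by apply: measurableI => //; exact: measurableC.
- exact: measurableC.
Qed.

Section support_extension.
Context (R : realType) (X Y : completeMetricType R) (mu : fmeas R X).
Variable psi : Defs.support mu -> Y.

(** Makes [psi] total, as image measures require. The constant value off the support keeps the map
    Borel. *)
Definition support_extension (x : X) : Y :=
  if pselect (Defs.support mu x) is left Sx then psi (SigSub (mem_set Sx))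
  else point.

Lemma support_extensionE z : support_extension (set_val z) = psi z.
Proof.
rewrite /support_extension; case: pselect => [Sz|]; last first.
  by case; exact: set_valP.
by congr psi; apply: val_inj.
Qed.

Hypothesis iso : isometric_on_support psi.

Lemma isometric_on_support_extension :
  isometric_on (metric_dist Y) (Defs.support mu) support_extension.
Proof.
move=> x y Sx Sy; have := iso (SigSub (mem_set Sx)) (SigSub (mem_set Sy)).
by rewrite -!support_extensionE.
Qed.

Lemma measurable_support_extension :
  measurable_fun setT (support_extension : borel X -> borel Y).
Proof.
apply: (measurable_isometric_on (y0 := point) (metrized_by_mdist (X := Y)) _
  isometric_on_support_extension); first exact: support_closed.
by move=> x Sx; rewrite /support_extension; case: pselect.
Qed.
End support_extension.

(** * Reduction of both infima to coupling costs *)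

Section Sturm_comparison.
Context (R : realType) (a : R) (F l : R -> \bar R).
Hypothesis regF : regular_ET a F l.
Context (X1 X2 : completeMetricType R) (mu1 : fmeas R X1) (mu2 : fmeas R X2).
Hypotheses (sep1 : separable X1) (sep2 : separable X2).

Let F0 : forall s : R, (0 <= s)%R -> 0 <= F s.
Proof. by have [] := regular_entropy regF. Qed.

Let mF : measurable_fun (`[0%R, +oo[%classic : set R) F.
Proof.
have [_ _ lscF _] := regular_entropy regF.
exact: lower_semicontinuous_subspace_measurable.
Qed.

Let Foo : superlinear F. Proof. exact: regular_superlinear regF. Qed.

Let l0 : forall s : R, (0 <= s)%R -> 0 <= l s.
Proof. exact: regular_cost_ge0 regF. Qed.

Let ml : measurable_fun (`[0%R, +oo[%classic : set R) l.
Proof.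
apply: lower_semicontinuous_subspace_measurable => //.
apply: continuous_lower_semicontinuous; exact: regular_cost_continuous regF.
Qed.

Lemma coupling_cost_ge0 (gamma : fmeas R (X1 * X2)%type)
    (d : pseudo_dist R (X1 + X2)%type) :
  0 <= coupling_cost F l mu1 mu2 gamma d.
Proof.
apply: adde_ge0; [apply: adde_ge0|].
- exact: (F_divergence_ge0 F0 Foo mu1 (image_measure gamma (@fst_borel X1 X2))).
- exact: (F_divergence_ge0 F0 Foo mu2 (image_measure gamma (@snd_borel X1 X2))).
- by apply: integral_ge0 => z _; apply: l0; exact: pdist_ge0.
Qed.

Definition coupling_costs : set (\bar R) :=
  [set coupling_cost F l mu1 mu2 p.1 p.2
   | p in [set p : fmeas R (X1 * X2)%type * pseudo_dist R (X1 + X2)%type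
          | pm_coupling p.2]].

Let coupling_costs_ge0 x : coupling_costs x -> 0 <= x.
Proof. by move=> [p _ <-]; exact: coupling_cost_ge0. Qed.


(** Serves both infima: the sets [S1] and [S2] are the supports for the Sturm distance and the whole
    spaces for a pseudo-metric coupling. The glued coupling depends on the embeddings only, so it is
    fixed before the plan. *)
Lemma coupling_costs_le_transport (Y : ptopologicalType) (d : pseudo_dist R Y)
    (psi1 : X1 -> Y) (psi2 : X2 -> Y) (S1 : set X1) (S2 : set X2)
    (nu1 nu2 : set (borel Y) -> \bar R) :
  metrized_by d ->
  measurable_fun setT (psi1 : borel X1 -> borel Y) ->
  measurable_fun setT (psi2 : borel X2 -> borel Y) ->
  (forall A, measurable A -> nu1 A = mu1 (psi1 @^-1` A)) ->
  (forall A, measurable A -> nu2 A = mu2 (psi2 @^-1` A)) ->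
  closed S1 -> closed S2 -> mu1 (~` S1) = 0 -> mu2 (~` S2) = 0 ->
  isometric_on d S1 psi1 -> isometric_on d S2 psi2 ->
  ereal_inf coupling_costs <= entropy_transport F (fun x y => l (d x y)) nu1 nu2.
Proof.
move=> dY mpsi1 mpsi2 nu1E nu2E cS1 cS2 S10 S20 iso1 iso2.
have [d' dc dE] := coupling_gluing iso1 iso2.
apply: le_ereal_inf_tmp => _ [gamma _ <-].
have [gamma' gammaP] := coupling_cost_le_transport F0 mF Foo l0 ml dY
  mpsi1 mpsi2 nu1E nu2E gamma sep1 sep2 cS1 cS2 S10 S20 iso1 iso2 dc dE.
by apply: le_trans gammaP; apply: ereal_inf_lbound; exists (gamma', d').
Qed.

Let a0 : (0 < a)%R. Proof. by have /andP[] := regular_exponent regF. Qed.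

Lemma ET_pdist_infE :
  ereal_inf [set ET_pdist a F l
      (pushforward mu1 (inl : borel X1 -> borel (pspace d)))
      (pushforward mu2 (inr : borel X2 -> borel (pspace d)))
      | d in [set d : pseudo_dist R (X1 + X2)%type | pm_coupling d]]
  = ereal_inf coupling_costs `^ a.
Proof.
pose et (d : pseudo_dist R (X1 + X2)%type) :=
  @entropy_transport R (pspace d) F (fun x y => l (d x y))
      (pushforward mu1 (inl : borel X1 -> borel (pspace d)))
      (pushforward mu2 (inr : borel X2 -> borel (pspace d))).
have iso1 d : pm_coupling d -> isometric_on d setT (inl : X1 -> pspace d).
  by move=> dc x y _ _; exact: dc.1.
have iso2 d : pm_coupling d -> isometric_on d setT (inr : X2 -> pspace d).
  by move=> dc x y _ _; exact: dc.2.
have m1 d : pm_coupling d -> measurable_fun setT (inl : borel X1 -> borel (pspace d)).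
  move=> /iso1; move/(isometric_continuous (@metrized_by_pspace R _ d)).
  exact: continuous_borel.
have m2 d : pm_coupling d -> measurable_fun setT (inr : borel X2 -> borel (pspace d)).
  move=> /iso2; move/(isometric_continuous (@metrized_by_pspace R _ d)).
  exact: continuous_borel.
rewrite -(@ereal_inf_poweR _ _ [set et d | d in [set d | pm_coupling d]])//.
- by rewrite image_comp.
- move=> _ [d dc <-].
  apply: (@coupling_costs_le_transport (pspace d) d inl inr setT setT) => //.
  + exact: metrized_by_pspace.
  + exact: m1.
  + exact: m2.
  + by rewrite setCT measure0.
  + by rewrite setCT measure0.
  + exact: iso1.
  + exact: iso2.
- move=> _ [[gamma d] /= dc <-]; exists (et d); first by exists d.
  apply: (@entropy_transport_le_coupling_cost _ _ _ F0 mF Foo l0 ml _ _ _ _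
    (pspace d) d _ inl inr) => //.
  + exact: metrized_by_pspace.
  + exact: m1.
  + exact: m2.
  + exact: iso1.
  + exact: iso2.
Qed.

Lemma Sturm_ETE : Sturm_ET a F l mu1 mu2 = ereal_inf coupling_costs `^ a.
Proof.
(* The costs before raising to the power [a], as [ereal_inf_poweR] expects. *)
pose A : set (\bar R) := [set v | exists Y : completeMetricType R,
    exists psi1 : Defs.support mu1 -> Y, exists psi2 : Defs.support mu2 -> Y,
    [/\ separable Y, isometric_on_support psi1, isometric_on_support psi2 &
        v = entropy_transport F (fun x y => l (mdist x y))
          (push_support psi1) (push_support psi2)]].
have -> : Sturm_ET a F l mu1 mu2 = ereal_inf [set x `^ a | x in A].
  congr ereal_inf; apply/seteqP;
    split=> [_ [Y [p1 [p2 [sY i1 i2 ->]]]]|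
      _ [_ [Y [p1 [p2 [sY i1 i2 ->]]]] <-]].
    by eexists; last reflexivity; exists Y, p1, p2.
  by exists Y, p1, p2.
apply: ereal_inf_poweR => //.
- move=> _ [Y [p1 [p2 [sY i1 i2 ->]]]].
  have dY := metrized_by_mdist (X := Y).
  apply: (@coupling_costs_le_transport Y (metric_dist Y)
    (support_extension p1) (support_extension p2)
    (Defs.support mu1) (Defs.support mu2)) => //.
  + exact: measurable_support_extension.
  + exact: measurable_support_extension.
  + move=> B mB; apply: push_supportE => //; last exact: support_extensionE.
    exact: measurable_support_extension.
  + move=> B mB; apply: push_supportE => //; last exact: support_extensionE.
    exact: measurable_support_extension.
  + exact: support_closed.
  + exact: support_closed.
  + exact: support_compl_null.
  + exact: support_compl_null.
  + exact: isometric_on_support_extension.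
  + exact: isometric_on_support_extension.
- move=> _ [[gamma d] /= dc <-].
  pose dcc := pm_coupling_complete dc.
  pose Y : completeMetricType R := metric_quotient dcc.
  have dY := metrized_by_mdist (X := Y).
  pose p1 (x : X1) : Y := to_quotient dcc (inl x).
  pose p2 (x : X2) : Y := to_quotient dcc (inr x).
  have iso1 : isometric_on (metric_dist Y) setT p1.
    by move=> x y _ _; rewrite -dc.1; exact: mdist_to_quotient.
  have iso2 : isometric_on (metric_dist Y) setT p2.
    by move=> x y _ _; rewrite -dc.2; exact: mdist_to_quotient.
  have m1 : measurable_fun setT (p1 : borel X1 -> borel Y).
    by apply: continuous_borel; exact: isometric_continuous dY iso1.
  have m2 : measurable_fun setT (p2 : borel X2 -> borel Y).
    by apply: continuous_borel; exact: isometric_continuous dY iso2.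
  (* The Sturm distance admits maps defined on the supports only; the isometries [p1] and [p2] of
     the whole spaces remain available as their extensions. *)
  pose q1 (x : Defs.support mu1) := p1 (set_val x).
  pose q2 (x : Defs.support mu2) := p2 (set_val x).
  exists (entropy_transport F (fun x y : Y => l (mdist x y))
    (push_support q1) (push_support q2)).
    exists Y, q1, q2; split => //.
    + exact: separable_coupling_quotient.
    + by move=> x y; exact: iso1.
    + by move=> x y; exact: iso2.
  apply: (@entropy_transport_le_coupling_cost _ _ _ F0 mF Foo l0 ml _ _ _ _
    Y (metric_dist Y) _ p1 p2) => //.
  + by move=> B mB; exact: push_supportE.
  + by move=> B mB; exact: push_supportE.
  + by move=> x y; rewrite -mdist_to_quotient.
Qed.

Lemma Sturm_ET_couplings :
  Sturm_ET a F l mu1 mu2 `^ (1 / a) = ereal_inf coupling_costs.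
Proof.
rewrite Sturm_ETE -poweRrM mulrA mulr1 divff ?gt_eqF// poweRe1//.
exact: le_ereal_inf_tmp.
Qed.

End Sturm_comparison.

Theorem proposition2 (R : realType) (a : R) (F l : R -> \bar R)
  (X1 X2 : completeMetricType R) (mu1 : fmeas R X1) (mu2 : fmeas R X2) :
  separable X1 -> separable X2 -> regular_ET a F l ->
  Sturm_ET a F l mu1 mu2 =
    ereal_inf [set ET_pdist a F l
      (pushforward mu1 (inl : borel X1 -> borel (pspace d)))
      (pushforward mu2 (inr : borel X2 -> borel (pspace d)))
      | d in [set d : pseudo_dist R (X1 + X2)%type | pm_coupling d]]
  /\
  Sturm_ET a F l mu1 mu2 `^ (1 / a) =
    ereal_inf [set
      F_divergence F (pushforward p.1 (fst : borel (X1 * X2)%type -> borel X1)) mu1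
      + F_divergence F (pushforward p.1 (snd : borel (X1 * X2)%type -> borel X2)) mu2
      + \int[p.1]_z l (p.2 (inl z.1) (inr z.2))
      | p in [set p : fmeas R (X1 * X2)%type * pseudo_dist R (X1 + X2)%type
             | pm_coupling p.2]].
Proof.
move=> sep1 sep2 regF; split; last exact: Sturm_ET_couplings.
by rewrite (Sturm_ETE regF)// ET_pdist_infE.
Qed.
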